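(* Let $m\ge1$ and $n\ge2$ be integers, let $G=(G_{ij})_{1\le i,j\le n}$ be an irreducible symmetric stochastic matrix with spectral gap $\gamma(G)$, and let $r_1,\ldots,r_n:\{0,1,2,\ldots\}\to[0,\infty)$ be rate functions with $r_i(0)=0$ and $r_i(k)>0$ for all $i\in\{1,\dots,n\}$ and $k\ge1$, such that for some constants $\delta,\Delta>0$, $$\delta\ \le\ r_i(k+1)-r_i(k)\ \le\ \Delta\qquad\text{for all } i\in\{1,\dots,n\}\text{ and all integers }k\ge0.$$ Then the log-Sobolev constant $t_{\mathrm{LS}}$ of the Zero-Range Process with $m$ particles, $n$ sites, geometry $G$ and rates $(r_i)_{1\le i\le n}$ satisfies $$t_{\mathrm{LS}}\ \le\ \frac{40\,\Delta}{\gamma(G)\,\delta^2}\log\left(\frac{\Delta mn}{\delta}\right).$$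
   Context: The Zero-Range Process with these parameters is the continuous-time Markov chain on $\mathcal X=\{x=(x_1,\ldots,x_n)\in\mathbb Z_+^n:\sum_{i=1}^n x_i=m\}$ with generator $$(Qf)(x)=\sum_{1\le i,j\le n} r_i(x_i)\,G_{ij}\left(f(x+\delta_j-\delta_i)-f(x)\right),$$ where $(\delta_1,\ldots,\delta_n)$ is the canonical basis of $\mathbb R^n$ (terms with $x_i=0$ vanish since $r_i(0)=0$). It is reversible with respect to the probability measure $\pi(x)\propto\prod_{i=1}^n\prod_{k=1}^{x_i}\frac1{r_i(k)}$ on $\mathcal X$. The spectral gap $\gamma(G)$ of a symmetric stochastic matrix $G$ is $1-\lambda_2(G)$, where $\lambda_2(G)$ is its second largest eigenvalue (counted with multiplicity). For a generator $Q$ on a finite set $\mathcal X$ reversible with respect to a probability measure $\pi$, let $\mathcal E(f,g)=\frac12\sum_{x,y\in\mathcal X}\pi(x)Q(x,y)(f(x)-f(y))(g(x)-g(y))$ and, for $f:\mathcal X\to(0,\infty)$, $\mathrm{Ent}(f)=\mathbf E[f\log f]-\mathbf E[f]\log\mathbf E[f]$, with $\mathbf E$ the expectation under $\pi$ and $\log$ natural. The log-Sobolev constant $t_{\mathrm{LS}}$ is the smallest $t\ge0$ such that $\mathrm{Ent}(f)\le t\,\mathcal E(\sqrt f,\sqrt f)$ for all $f:\mathcal X\to(0,\infty)$. *)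

(* Defs.v *)
From HB Require Import structures.
From mathcomp Require Import all_boot all_order all_algebra.
From mathcomp Require Import all_classical all_reals all_analysis.
From mathcomp.real_closed Require polyrcf.

Set Implicit Arguments.
Unset Strict Implicit.
Unset Printing Implicit Defensive.

Import Order.TTheory GRing.Theory Num.Theory.

Local Open Scope classical_set_scope.
Local Open Scope ring_scope.

Section StochasticMatrix.
Variables (R : realType) (n : nat).
Implicit Type G : 'M[R]_n.

Definition stochastic G : Prop :=
  (forall i j, 0 <= G i j) /\ (forall i, \sum_j G i j = 1).

Definition irreducible G : Prop := forall i j, exists k : nat, 0 < (G ^+ k) i j.

(* Real eigenvalues in nonincreasing order, each repeated according to its
   multiplicity as a root of the characteristic polynomial. For a symmetric G
   these are all n eigenvalues. *)
Definition eigenvalues G : seq R :=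
  sort >=%R (flatten [seq nseq (mup a (char_poly G)) a
                     | a <- polyrcf.rootsR (char_poly G)]).

(* [1] is the second entry; it exists for a symmetric G as soon as n >= 2. *)
Definition spectral_gap G : R := 1 - nth 0 (eigenvalues G) 1.

End StochasticMatrix.

Section LogSobolev.
Variables (R : realType) (X : finType).
Variables (Q : X -> X -> R) (pi : X -> R).
Implicit Types f g : X -> R.

Definition expect f : R := \sum_x pi x * f x.

Definition dirichlet f g : R :=
  2^-1 * \sum_x \sum_y pi x * Q x y * (f x - f y) * (g x - g y).

Definition Ent f : R :=
  expect (fun x => f x * ln (f x)) - expect f * ln (expect f).

Definition log_sobolev (t : R) : Prop :=
  forall f, (forall x, 0 < f x) ->
    Ent f <= t * dirichlet (fun x => Num.sqrt (f x)) (fun x => Num.sqrt (f x)).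

(* The set of admissible t is closed, so the infimum is a minimum whenever that
   set is nonempty; it is +oo when no t is admissible. *)
Definition t_LS : \bar R :=
  ereal_inf [set t%:E | t in [set t : R | 0 <= t /\ log_sobolev t]].

End LogSobolev.

(* Coordinates are taken in {0, ..., m}, which loses nothing since they are
   nonnegative with sum m; this makes the state space a finType. *)
Definition config (n m : nat) : finType :=
  {x : {ffun 'I_n -> 'I_m.+1} | (\sum_i x i == m)%N}.

Section ZeroRange.
Variables (R : realType) (n m : nat).
Variables (G : 'M[R]_n) (r : 'I_n -> nat -> R).
Implicit Types (x y : config n m) (i j : 'I_n).

Definition occ x i : nat := val x i.

(* x + delta_j - delta_i, see hopE. When x_i = 0 the value is irrelevant, as it
   is always weighted by r_i(0) = 0. *)
Definition hop x i j : config n m :=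
  insubd x [ffun k => inord (occ x k + (k == j) - (k == i))].

Lemma hopE x i j k : (0 < occ x i)%N ->
  occ (hop x i j) k = (occ x k + (k == j) - (k == i))%N.
Proof.
move=> xi0.
pose h l := (occ x l + (l == j) - (l == i))%N.
have sx : (\sum_l occ x l = m)%N by apply/eqP; exact: (valP x).
have hD l : (h l + (l == i) = occ x l + (l == j))%N.
  by rewrite /h subnK //; case: eqP => // ->; rewrite ltn_addr.
have sum1 a : (\sum_(l < n) (l == a) = 1)%N.
  by rewrite (bigD1 a) //= eqxx big1 ?addn0 // => l /negbTE ->.
have sh : (\sum_l h l = m)%N.
  apply/eqP; rewrite -(eqn_add2r 1) -{1}(sum1 i) -big_split /=.
  by rewrite (eq_bigr _ (fun l _ => hD l)) big_split /= sum1 sx.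
have hm l : (h l < m.+1)%N by rewrite ltnS -sh (bigD1 l) //= leq_addr.
rewrite /occ /hop val_insubd ifT ?ffunE ?inordK ?hm //.
apply/eqP; rewrite -[RHS]sh; apply: eq_bigr => l _.
by rewrite ffunE inordK ?hm.
Qed.

Definition zrp_op (f : config n m -> R) x : R :=
  \sum_i \sum_j r i (occ x i) * G i j * (f (hop x i j) - f x).

(* The matrix entry Q(x, y) of the operator f |-> Q f. *)
Definition zrp_gen x y : R := zrp_op (fun z => (z == y)%:R) x.

Definition zrp_weight x : R :=
  \prod_i \prod_(1 <= k < (occ x i).+1) (r i k)^-1.

Definition zrp_pi x : R := zrp_weight x / \sum_y zrp_weight y.

Definition zrp_t_LS : \bar R := t_LS zrp_gen zrp_pi.

End ZeroRange.

(* Main.v *)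
(** Grouping the jumps [y + delta_i -> y + delta_j] by the configuration [y] of
    the [m - 1] other particles turns the Dirichlet form of the zero-range process
    into a sum of quadratic forms of [G], so that the Poincare inequality for [G]
    reduces the theorem to the complete graph.

    On the complete graph, condition on the occupation of one site, average over
    the site, and induct on the number of sites (the martingale method of Lu and
    Yau). The conditional means given [k] and [k + 1] particles at that site are
    compared through the stationary law of a zero-range process with a
    second-class particle, whose density is at most [Delta / (delta n)] by the
    maximum principle (the idea of Hermon and Salez). As [(sqrt a - sqrt b)^2] is
    jointly convex, this leaves a log-Sobolev inequality for a birth-death chain.

    For that chain, with generator [L], one step of the kernel [1 + eps L] contracts
    the Dirichlet form of [sqrt f] by [1 - eps delta], and the entropy it loses
    is a sum of entropies under the transition probabilities. These have three
    atoms of mass at least [1 / T], which costs a factor [ln T], where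
    [T = 2 Delta m n / delta]; summing over the steps gives the inequality. *)

Require Import Defs.
From mathcomp Require Import all_boot all_order all_algebra.
From mathcomp Require Import all_classical all_reals all_analysis.
From mathcomp Require Import ring lra.
From mathcomp.real_closed Require complex polyrcf.
Set Implicit Arguments.
Unset Strict Implicit.
Unset Printing Implicit Defensive.
Import Order.TTheory GRing.Theory Num.Theory numFieldNormedType.Exports.
Local Open Scope ring_scope.

(** * One-dimensional entropy inequalities *)

Section ScalarInequality.
Variable R : realType.
Implicit Types s x T : R.

(** The obstacle is that the conditional law of the other sites changes with the occupation of the
    chosen one. Comparing its means for [k] and [k + 1] particles has to cost only moves of one
    particle, at a price free of [k]. A coupling that adds one particle at a random site [j]
    achieves this, because the bound on the density of [(x, j)] lets [x] return to the product
    weights while [j] is summed over all sites. The same coupling makes the birth rates of the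
    one-site chain monotone, which its contraction uses.

    A discrete step [1 + eps L] makes the lost entropy an entropy under a law with three atoms, the
    only place where a logarithm enters; [eps] cancels between loss and contraction.

    The constant 40: [5/2 ln T] per atom, 5 after recentring the squares, 10 since each edge is seen
    from both ends, 20 from the 1/2 in the Dirichlet form, 40 from [ln (2 M) <= 2 ln M] with
    [M = Delta m n / delta]. One [1 / delta] is the contraction rate, [Delta / delta] the density
    bound; the induction on sites loses nothing. *)

Lemma ln_le_sub1 x : 0 < x -> ln x <= x - 1.
Proof. by move=> x0; have := expR_ge1Dx (ln x); rewrite lnK ?posrE //; lra. Qed.

Lemma ln_ge_1subV x : 0 < x -> 1 - x^-1 <= ln x.
Proof.
move=> x0; have := @ln_le_sub1 x^-1; rewrite invr_gt0 lnV ?posrE // => /(_ x0).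
lra.
Qed.

Lemma ln2_ge : 3 / 5 <= ln (2 : R).
Proof.
(* The bound [1 - 1/x] on the three factors adds up to [1/4 + 1/5 + 1/6 = 37/60]; on 2 itself it
   would give only [1/2]. *)
have -> : 2 = 4 / 3 * (5 / 4) * (6 / 5) :> R by lra.
rewrite (lnM (x := _ * _)) ?(lnM (x := 4 / 3)) ?posrE ?mulr_gt0 ?divr_gt0 //.
have h (a b : R) : 0 < a -> 0 < b -> 1 - b / a <= ln (a / b).
  by move=> a0 b0; rewrite -invf_div ln_ge_1subV // divr_gt0.
have := h 4 3; have := h 5 4; have := h 6 5; rewrite !ltr0n.
move=> /(_ isT isT) k1 /(_ isT isT) k2 /(_ isT isT) k3. lra.
Qed.

(** With [s = e^u] this is [u <= sinh u]. For [s > 1] it yields the factor [s + 1] in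
    [entropy_le_sqr], where [ln s <= s - 1] would yield [2 s + 1]. *)
Lemma ln_le_sinh s : 1 <= s -> 2 * ln s <= s - s^-1.
Proof.
move=> s1.
pose f (x : R) := x - x^-1 - 2 * ln x.
have df x : 0 < x -> is_derive x 1 f (1 + x ^- 2 - 2 * x^-1).
  move=> x0; have xn0 : x != 0 by rewrite gt_eqF.
  have h2 := @is_deriveV R id x 1 1 xn0 (is_derive_id x 1).
  have h3 := is_derive1_ln x0.
  have h4 := is_deriveZ 2 h3.
  have h5 := is_deriveB (is_deriveB (is_derive_id x 1) h2) h4.
  apply: (is_derive_eq h5).
  by rewrite /GRing.scale /= mulr1 opprK.
have cf : {within `[1, s]%classic, continuous f}%classic.
  apply: derivable_within_continuous => x; rewrite in_itv /= => /andP[x1 _].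
  by have [] := df x (lt_le_trans ltr01 x1).
have := @ger0_derive1_ndecr R f 1 s _ _ cf 1 s (lexx _) s1 (lexx _).
rewrite /f invr1 ln1 mulr0 subrr subr0.
have -> : (0 <= s - s^-1 - 2 * ln s) = (2 * ln s <= s - s^-1) by rewrite subr_ge0.
apply.
  move=> x; rewrite in_itv /= => /andP[x1 _].
  by have [] := df x (lt_trans ltr01 x1).
move=> x; rewrite in_itv /= => /andP[x1 _].
have x0 := lt_trans ltr01 x1.
rewrite derive1E; have [_ ->] := df x x0.
have -> : 1 + x ^- 2 - 2 * x^-1 = (1 - x^-1) ^+ 2 by field; rewrite gt_eqF.
exact: sqr_ge0.
Qed.

(** Meant for [s^2 = f / E]. The left side divided by [(s - 1)^2] grows like [2 ln s], whence the
    factor [ln T]; [T >= 4] keeps that factor away from 0 for small [s]. *)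
Lemma entropy_le_sqr T s : 4 <= T -> 0 < s -> s ^+ 2 <= T ->
  s ^+ 2 * ln (s ^+ 2) - s ^+ 2 + 1 <= 5 / 2 * ln T * (s - 1) ^+ 2.
Proof.
move=> T4 s0 sT.
have l2 := ln2_ge.
have lT : 2 * ln 2 <= ln T.
  have -> : 2 * ln 2 = ln (4 : R).
    have -> : 4 = 2 ^+ 2 :> R by rewrite expr2; lra.
    by rewrite lnXn // mulr_natl.
  by rewrite ler_ln // posrE //; lra.
have lsT : 2 * ln s <= ln T.
  rewrite mulr_natl -lnXn // ler_ln // posrE ?exprn_gt0 //.
  by apply: lt_le_trans T4.
rewrite lnXn // -[ln s *+ 2]mulr_natl.
have q0 : 0 <= (s - 1) ^+ 2 := sqr_ge0 _.
have [s1|s1] := leP s 1.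
  have h := ln_le_sub1 s0.
  have h1 : s ^+ 2 * ln s <= s ^+ 2 * (s - 1) by rewrite ler_pM2l ?exprn_gt0.
  have h2 : (2 * s + 1) * (s - 1) ^+ 2 <= 5 / 2 * ln T * (s - 1) ^+ 2.
    by apply: ler_wpM2r => //; lra.
  apply: le_trans h2; move: h1; rewrite !expr2; lra.
have ge0 : 0 <= s ^+ 2 by rewrite sqr_ge0.
(* From [11 / 4] on, [s^2 <= 5/2 (s - 1)^2], so [2 ln s <= ln T] suffices, the terms [- s^2 + 1]
   being negative. *)
have [s3|s3] := leP (11 / 4) s.
  have h1 : s ^+ 2 * (2 * ln s) <= s ^+ 2 * ln T by apply: ler_wpM2l.
  have h2 : s ^+ 2 <= 5 / 2 * (s - 1) ^+ 2 by rewrite !expr2; nra.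
  have h3 : s ^+ 2 * ln T <= 5 / 2 * (s - 1) ^+ 2 * ln T.
    by apply: ler_wpM2r => //; lra.
  have h4 : 1 <= s ^+ 2 by rewrite expr2; nra.
  lra.
have h := ln_le_sinh (ltW s1).
have h1 : s ^+ 2 * (2 * ln s) <= s * (s ^+ 2 - 1).
  have -> : s * (s ^+ 2 - 1) = s ^+ 2 * (s - s^-1) by field; rewrite gt_eqF.
  exact: ler_wpM2l.
(* Up to 2 this is [ln T >= 6/5]; beyond, [ln s >= ln 2 + 1 - 2/s] reduces it to
   [(s - 2) (s - 5) <= 0]. *)
have h2 : s + 1 <= 5 / 2 * ln T.
  have [s2|s2] := leP s 2; first lra.
  have := @ln_ge_1subV (s / 2); rewrite divr_gt0 // ln_div ?posrE // invf_div.
  move=> /(_ isT) k.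
  have k2 : s + 1 <= 5 * (8 / 5 - 2 / s).
    rewrite -(ler_pM2r s0).
    have -> : 5 * (8 / 5 - 2 / s) * s = 8 * s - 10 by field; rewrite gt_eqF.
    nra.
  lra.
have h3 : (s + 1) * (s - 1) ^+ 2 <= 5 / 2 * ln T * (s - 1) ^+ 2.
  exact: ler_wpM2r.
apply: le_trans h3; move: h1; rewrite !expr2; lra.
Qed.
End ScalarInequality.

(** * The square-root distance and the entropy of a law with three atoms *)

Section Psi.
Variable R : realType.
Implicit Types a b c : R.

Definition sqdist a b : R := (Num.sqrt a - Num.sqrt b) ^+ 2.

Lemma sqdist_ge0 a b : 0 <= sqdist a b.
Proof. exact: sqr_ge0. Qed.

Lemma sqdistC a b : sqdist a b = sqdist b a.
Proof. by rewrite /sqdist -opprB sqrrN. Qed.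

Lemma sqdistxx a : sqdist a a = 0.
Proof. by rewrite /sqdist subrr expr0n. Qed.

Lemma sqdistZ c a b : 0 <= c -> sqdist (c * a) (c * b) = c * sqdist a b.
Proof.
move=> c0; rewrite /sqdist !sqrtrM // -mulrBr exprMn sqr_sqrtr //.
Qed.

(* Cauchy-Schwarz: [sqrt a sqrt b + sqrt a' sqrt b'] is at most
   [sqrt (a + a') sqrt (b + b')]. *)
Lemma sqdistD a b a' b' : 0 <= a -> 0 <= b -> 0 <= a' -> 0 <= b' ->
  sqdist (a + a') (b + b') <= sqdist a b + sqdist a' b'.
Proof.
move=> a0 b0 a'0 b'0.
have cs : Num.sqrt a * Num.sqrt b + Num.sqrt a' * Num.sqrt b' <=
          Num.sqrt (a + a') * Num.sqrt (b + b').
  rewrite -(@ler_pXn2r _ 2) ?nnegrE ?addr_ge0 ?mulr_ge0 ?sqrtr_ge0 //.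
  rewrite exprMn !sqr_sqrtr ?addr_ge0 //.
  have := sqr_sqrtr a0; have := sqr_sqrtr b0.
  have := sqr_sqrtr a'0; have := sqr_sqrtr b'0.
  set x := Num.sqrt a; set y := Num.sqrt b; set z := Num.sqrt a'.
  set t := Num.sqrt b' => <- <- <- <-.
  rewrite -subr_ge0.
  have -> : (x ^+ 2 + z ^+ 2) * (y ^+ 2 + t ^+ 2) - (x * y + z * t) ^+ 2
            = (x * t - z * y) ^+ 2 by ring.
  exact: sqr_ge0.
rewrite /sqdist !sqrrB !sqr_sqrtr ?addr_ge0 //.
rewrite !mulr2n; lra.
Qed.

(** Follows from homogeneity and subadditivity, hence for weights of any total mass; for mass 1 it
    is Jensen's inequality. *)
Lemma sqdist_sum (I : Type) (s : seq I) (p a b : I -> R) :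
  (forall i, 0 <= p i) -> (forall i, 0 <= a i) -> (forall i, 0 <= b i) ->
  sqdist (\sum_(i <- s) p i * a i) (\sum_(i <- s) p i * b i)
    <= \sum_(i <- s) p i * sqdist (a i) (b i).
Proof.
move=> p0 a0 b0; elim: s => [|i s IH]; first by rewrite !big_nil sqdistxx.
rewrite !big_cons -sqdistZ //.
apply: le_trans (sqdistD _ _ _ _) _; rewrite ?mulr_ge0 ?sumr_ge0 //.
- by move=> *; rewrite mulr_ge0.
- by move=> *; rewrite mulr_ge0.
by rewrite lerD2l.
Qed.

Lemma entropy_atom (T p f E : R) : 4 <= T -> 0 <= p -> p = 0 \/ 1 <= T * p ->
  0 < f -> 0 < E -> p * f <= E ->
  p * (f * ln f - f * ln E - f + E)
    <= 5 / 2 * ln T * (p * (Num.sqrt f - Num.sqrt E) ^+ 2).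
Proof.
move=> T4 p0 [->|pT] f0 E0 pfE; first by rewrite !mul0r mulr0.
rewrite [leRHS]mulrCA; apply: ler_wpM2l => //.
pose s := Num.sqrt f / Num.sqrt E.
have sE0 : 0 < Num.sqrt E by rewrite sqrtr_gt0.
have s0 : 0 < s by rewrite divr_gt0 ?sqrtr_gt0.
have s2 : s ^+ 2 = f / E by rewrite exprMn exprVn !sqr_sqrtr // ltW.
(* On an atom of mass at least [1 / T] a positive function is at most [T] times its mean:
   [f <= T p f <= T E]. *)
have sT : s ^+ 2 <= T.
  rewrite s2 ler_pdivrMr //.
  have : T * (p * f) <= T * E by rewrite ler_pM2l //; lra.
  have : f <= T * p * f by rewrite ler_peMl // ltW.
  lra.
have := ler_wpM2l (ltW E0) (entropy_le_sqr T4 s0 sT).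
rewrite s2 ln_div ?posrE //.
have -> : E * (f / E * (ln f - ln E) - f / E + 1) =
          f * ln f - f * ln E - f + E by field; rewrite gt_eqF.
move=> /le_trans; apply.
have -> : (Num.sqrt f - Num.sqrt E) = Num.sqrt E * (s - 1).
  by rewrite /s mulrBr mulr1 mulrCA divff ?mulr1 // gt_eqF.
by rewrite exprMn sqr_sqrtr ?(ltW E0) //; lra.
Qed.

(** The entropy is the sum of [p E phi(f / E)] with [phi(u) = u ln u - u + 1], so [entropy_atom]
    applies with squares centred at [sqrt E]. Moving the centre to an arbitrary [c] costs a factor
    2. *)
Lemma entropy_three_atoms (T p1 p2 p3 f1 f2 f3 c E : R) : 4 <= T ->
  0 <= p1 -> p1 = 0 \/ 1 <= T * p1 -> 0 <= p2 -> p2 = 0 \/ 1 <= T * p2 ->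
  0 <= p3 -> p3 = 0 \/ 1 <= T * p3 -> p1 + p2 + p3 = 1 ->
  0 < f1 -> 0 < f2 -> 0 < f3 ->
  E = p1 * f1 + p2 * f2 + p3 * f3 ->
  p1 * (f1 * ln f1) + p2 * (f2 * ln f2) + p3 * (f3 * ln f3) - E * ln E
  <= 5 * ln T * (p1 * (Num.sqrt f1 - c) ^+ 2 + p2 * (Num.sqrt f2 - c) ^+ 2
                 + p3 * (Num.sqrt f3 - c) ^+ 2).
Proof.
move=> T4 p10 p1T p20 p2T p30 p3T p_sum f10 f20 f30 eE.
have q1 : 0 <= p1 * f1 by rewrite mulr_ge0 // ltW.
have q2 : 0 <= p2 * f2 by rewrite mulr_ge0 // ltW.
have q3 : 0 <= p3 * f3 by rewrite mulr_ge0 // ltW.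
have E0 : 0 < E.
  have [h|h|h] : [\/ 0 < p1, 0 < p2 | 0 < p3].
  - have [?|?] := ltP 0 p1; first by constructor 1.
    by have [?|?] := ltP 0 p2; [constructor 2|constructor 3; lra].
  - by have : 0 < p1 * f1 := mulr_gt0 h f10; rewrite eE; lra.
  - by have : 0 < p2 * f2 := mulr_gt0 h f20; rewrite eE; lra.
  - by have : 0 < p3 * f3 := mulr_gt0 h f30; rewrite eE; lra.
have a1 : p1 * f1 <= E by rewrite eE; lra.
have a2 : p2 * f2 <= E by rewrite eE; lra.
have a3 : p3 * f3 <= E by rewrite eE; lra.
have h1 := entropy_atom T4 p10 p1T f10 E0 a1.
have h2 := entropy_atom T4 p20 p2T f20 E0 a2.
have h3 := entropy_atom T4 p30 p3T f30 E0 a3.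
have l0 : 0 <= ln T by apply: ln_ge0; lra.
have e0 : 0 < Num.sqrt E by rewrite sqrtr_gt0.
have e2 := sqr_sqrtr (ltW E0).
have s1 := sqr_sqrtr (ltW f10); have s2 := sqr_sqrtr (ltW f20).
have s3 := sqr_sqrtr (ltW f30).
have x1 := sqrtr_ge0 f1; have x2 := sqrtr_ge0 f2; have x3 := sqrtr_ge0 f3.
move: (Num.sqrt f1) (Num.sqrt f2) (Num.sqrt f3) (Num.sqrt E) s1 s2 s3 e2 x1 x2 x3 e0 h1 h2 h3.
move=> x1 x2 x3 e s1 s2 s3 e2 x10 x20 x30 e0 h1 h2 h3.
set A := p1 * x1 + p2 * x2 + p3 * x3.
have A0 : 0 <= A by rewrite !addr_ge0 ?mulr_ge0.
(* Bias and variance: [A] is the mean of [sqrt f] and [e^2 = E] its second moment. *)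
have var c' : p1 * (x1 - c') ^+ 2 + p2 * (x2 - c') ^+ 2 + p3 * (x3 - c') ^+ 2
           = e ^+ 2 - A ^+ 2 + (A - c') ^+ 2.
  have -> : p1 = 1 - p2 - p3 by lra.
  rewrite e2 eE -s1 -s2 -s3 /A.
  have -> : p1 = 1 - p2 - p3 by lra.
  ring.
have Ae : A <= e.
  rewrite -(@ler_pXn2r _ 2) ?nnegrE ?(ltW e0) // -subr_ge0.
  have := var A; rewrite subrr expr0n /= addr0 => <-.
  by rewrite ?addr_ge0 // mulr_ge0 // sqr_ge0.
(* The left side is [2 e (e - A)], at most twice the variance [(e + A) (e - A)], and no centre gives
   less than the variance. *)
have V : p1 * (x1 - e) ^+ 2 + p2 * (x2 - e) ^+ 2 + p3 * (x3 - e) ^+ 2 <=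
   2 * (p1 * (x1 - c) ^+ 2 + p2 * (x2 - c) ^+ 2 + p3 * (x3 - c) ^+ 2).
  rewrite !var; have := sqr_ge0 (A - c).
  have : 0 <= (e - A) * A by rewrite mulr_ge0 // subr_ge0.
  rewrite !expr2; lra.
have : ln T * (p1 * (x1 - e) ^+ 2 + p2 * (x2 - e) ^+ 2 + p3 * (x3 - e) ^+ 2) <=
   ln T * (2 * (p1 * (x1 - c) ^+ 2 + p2 * (x2 - c) ^+ 2 + p3 * (x3 - c) ^+ 2)).
  exact: ler_wpM2l.
have -> : p1 * (f1 * ln f1) + p2 * (f2 * ln f2) + p3 * (f3 * ln f3) - E * ln E
  = p1 * (f1 * ln f1 - f1 * ln E - f1 + E) + p2 * (f2 * ln f2 - f2 * ln E - f2 + E)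
   + p3 * (f3 * ln f3 - f3 * ln E - f3 + E).
  rewrite eE; set l := ln _.
  have -> : p1 = 1 - p2 - p3 by lra.
  by ring.
lra.
Qed.
End Psi.

(** * Birth-death chains *)

Section Entropy.
Variables (R : realType) (I : Type).
Implicit Types (s : seq I) (w f : I -> R).

(* The measure with weights [w] is not normalized to mass 1. *)
Definition entropy s w f : R :=
  \sum_(x <- s) w x * (f x * ln (f x))
  - (\sum_(x <- s) w x * f x) *
    ln ((\sum_(x <- s) w x * f x) / \sum_(x <- s) w x).

End Entropy.

Lemma entropy_const (R : realType) (T : eqType) (s : seq T) (w f : T -> R) :
  (forall x, x \in s -> 0 < w x) ->
  (forall x y, x \in s -> y \in s -> f x = f y) -> entropy s w f = 0.
Proof.
case: s => [|x0 s] w0 fc; first by rewrite /entropy !big_nil mul0r subrr.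
have e (g : R -> R) : \sum_(x <- x0 :: s) w x * g (f x) = (\sum_(x <- x0 :: s) w x) * g (f x0).
  rewrite mulr_suml !big_seq; apply: eq_bigr => x xs.
  by rewrite (fc x x0) // inE eqxx.
rewrite /entropy (e (fun a => a * ln a)) (e id).
set W := \sum_(x <- _) w x.
have W0 : 0 < W.
  rewrite /W big_cons ltr_pwDl ?w0 ?mem_head // big_seq sumr_ge0 // => x xs.
  by rewrite ltW // w0 // inE xs orbT.
by rewrite [W * _ / W]mulrAC divff ?gt_eqF // mul1r mulrA subrr.
Qed.

Section BirthDeath.
Variables (R : realType) (K : nat) (nu r b : nat -> R) (delta eps T : R).
Hypothesis nu_gt0 : forall k, (k <= K)%N -> 0 < nu k.
Hypothesis balance : forall k, (k < K)%N -> nu k.+1 * r k.+1 = nu k * b k.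
Hypothesis r0 : r 0%N = 0.
Hypothesis bK : b K = 0.
Hypothesis r_ge0 : forall k, (k <= K)%N -> 0 <= r k.
Hypothesis b_gt0 : forall k, (k < K)%N -> 0 < b k.
Hypothesis r_incr : forall k, (k < K)%N -> r k + delta <= r k.+1.
Hypothesis b_decr : forall k, (k < K)%N -> b k.+1 <= b k.
Hypothesis delta_gt0 : 0 < delta.
Hypothesis eps_gt0 : 0 < eps.
Hypothesis T4 : 4 <= T.
(** [eps_couple] leaves room to move both coupled chains within one step; the three hypotheses after
    it bound every nonzero transition probability of [1 + eps L] below by [1 / T]. *)
Hypothesis eps_couple : forall k, (k < K)%N -> eps * (b k + r k.+1) <= 1.
Hypothesis stayT : forall k, (k <= K)%N -> 1 <= T * (1 - eps * (b k + r k)).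
Hypothesis deathT : forall k, (k < K)%N -> 1 <= T * (eps * r k.+1).
Hypothesis birthT : forall k, (k < K)%N -> 1 <= T * (eps * b k).
Implicit Types f h : nat -> R.

(** The jumps out of [0..K] carry the factors [b K = 0] and [r 0 = 0], so the formula makes no case
    distinction at the ends. *)
Definition bd_step f k : R :=
  f k + eps * (b k * (f k.+1 - f k) + r k * (f k.-1 - f k)).

Definition bd_form f : R :=
  \sum_(k < K) nu k * b k * sqdist (f k.+1) (f k).

Let Ent f := entropy (index_iota 0 K.+1) nu f.

Lemma bd_form_ge0 f : 0 <= bd_form f.
Proof.
by apply: sumr_ge0 => k _; rewrite mulr_ge0 ?sqdist_ge0 // ltW // mulr_gt0 ?b_gt0 // nu_gt0 // ltnW.
Qed.

Let stay_ge0 k : (k <= K)%N -> 0 <= 1 - eps * (b k + r k).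
Proof.
move=> kK; have h1 := stayT kK; have T0 : 0 < T by apply: lt_le_trans T4.
by rewrite -(pmulr_rge0 _ T0); apply: le_trans h1.
Qed.

Let bge0 k : (k <= K)%N -> 0 <= b k.
Proof. by rewrite leq_eqVlt => /predU1P[->|/b_gt0/ltW //]; rewrite bK. Qed.

Lemma bd_step_bounds f mu U : (forall k, (k <= K)%N -> mu <= f k <= U) ->
  forall k, (k <= K)%N -> mu <= bd_step f k <= U.
Proof.
move=> fb k kK.
have -> : bd_step f k = (1 - eps * (b k + r k)) * f k + eps * b k * f k.+1
    + eps * r k * f k.-1 by rewrite /bd_step; ring.
have h1 : eps * b k * mu <= eps * b k * f k.+1 <= eps * b k * U.
  move: kK; rewrite leq_eqVlt => /predU1P[->|kK].
    by rewrite bK mulr0 !mul0r !lexx.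
  have /andP[h1 h2] := fb _ kK.
  by rewrite !ler_pM2l ?mulr_gt0 ?b_gt0 ?h1.
have h2 : eps * r k * mu <= eps * r k * f k.-1 <= eps * r k * U.
  have /andP[h2 h3] := fb k.-1 (leq_trans (leq_pred _) kK).
  have e : 0 <= eps * r k by rewrite mulr_ge0 ?r_ge0 // ltW.
  by rewrite !ler_wpM2l.
have h3 : (1 - eps * (b k + r k)) * mu <= (1 - eps * (b k + r k)) * f k
          <= (1 - eps * (b k + r k)) * U.
  have /andP[h4 h5] := fb k kK.
  by rewrite !ler_wpM2l ?stay_ge0.
move: h1 h2 h3 => /andP[h1 h1'] /andP[h2 h2'] /andP[h3 h3'].
by apply/andP; split; lra.
Qed.

Lemma bd_stationary f :
  \sum_(k < K.+1) nu k * bd_step f k = \sum_(k < K.+1) nu k * f k.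
Proof.
under eq_bigr => k _ do rewrite mulrDr mulrCA mulrDr.
rewrite big_split /= -mulr_sumr big_split /=.
rewrite [X in _ + eps * (X + _)]big_ord_recr /= bK mul0r mulr0 addr0.
rewrite [X in _ + eps * (_ + X)]big_ord_recl /= r0 mul0r mulr0 add0r.
rewrite -big_split /= [X in eps * X]big1 ?mulr0 ?addr0 // => k _.
by rewrite /bump /= add0n !add1n !mulrA balance //; ring.
Qed.

(* The chains started at [k] and [k.+1] are coupled so as to stay one apart
   until they meet, which they do with probability at least [eps * delta]
   per step. *)
Lemma bd_step_sqdist f : (forall k, (k <= K)%N -> 0 < f k) ->
  forall k, (k < K)%N ->
  sqdist (bd_step f k.+1) (bd_step f k)
   <= eps * b k.+1 * sqdist (f k.+2) (f k.+1)
    + eps * r k * sqdist (f k) (f k.-1)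
    + (1 - eps * (b k + r k.+1)) * sqdist (f k.+1) (f k).
Proof.
move=> f0 k kK.
have fk : 0 < f k by apply: f0; apply: ltnW.
have fk1 : 0 < f k.+1 by apply: f0.
have fkp : 0 < f k.-1 by apply: f0; apply: leq_trans (leq_pred _) (ltnW kK).
have e0 := ltW eps_gt0.
have c1 : 0 <= eps * r k by rewrite mulr_ge0 // r_ge0 // ltnW.
have c2 : 0 <= 1 - eps * (b k + r k.+1) by rewrite subr_ge0 eps_couple.
have c3 : 0 <= eps * b k.+1 by rewrite mulr_ge0 // bge0.
have c4 : 0 <= eps * (b k - b k.+1) by rewrite mulr_ge0 // subr_ge0 b_decr.
have c5 : 0 <= eps * (r k.+1 - r k).
  by rewrite mulr_ge0 // subr_ge0; have := r_incr kK; have := delta_gt0; lra.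
have f2 : 0 <= eps * b k.+1 * f k.+2.
  move: kK; rewrite leq_eqVlt => /predU1P[->|kK]; first by rewrite bK mulr0 mul0r.
  by rewrite mulr_ge0 // ltW // f0.
(* The part where the chains meet: the lower one moves up at the excess rate [b k - b k.+1], or the
   upper one moves down at the excess rate [r k.+1 - r k]. It enters both values equally, so it adds
   nothing to the distance. *)
set m := eps * (b k - b k.+1) * f k.+1 + eps * (r k.+1 - r k) * f k.
have m0 : 0 <= m by rewrite addr_ge0 // mulr_ge0 // ltW.
have -> : bd_step f k.+1 = eps * b k.+1 * f k.+2 + (eps * r k * f k
   + ((1 - eps * (b k + r k.+1)) * f k.+1 + m)) by rewrite /bd_step /m /=; ring.
have -> : bd_step f k = eps * b k.+1 * f k.+1 + (eps * r k * f k.-1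
   + ((1 - eps * (b k + r k.+1)) * f k + m)) by rewrite /bd_step /m /=; ring.
have H (u v : R) : 0 <= u -> 0 < v -> 0 <= u * v by move=> ? ?; rewrite mulr_ge0 // ltW.
have n1 := H _ _ c3 fk1; have n2 := H _ _ c1 fk; have n3 := H _ _ c1 fkp.
have n4 := H _ _ c2 fk1; have n5 := H _ _ c2 fk.
have n6 := addr_ge0 n4 m0; have n7 := addr_ge0 n5 m0.
apply: le_trans (sqdistD f2 n1 (addr_ge0 n2 n6) (addr_ge0 n3 n7)) _.
rewrite -[leRHS]addrA; apply: lerD.
  have [e|e] := eqVneq k.+1 K; first by rewrite e bK mulr0 !mul0r sqdistxx.
  by rewrite sqdistZ.
apply: le_trans (sqdistD n2 n3 n6 n7) _.
apply: lerD; first by rewrite sqdistZ.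
apply: le_trans (sqdistD n4 n5 m0 m0) _.
by rewrite sqdistxx addr0 sqdistZ.
Qed.

Lemma sum_ord_shift (G : nat -> R) :
  \sum_(k < K) G k.+1 = \sum_(k < K) G k + G K - G 0%N.
Proof.
have : \sum_(k < K.+1) G k = G 0%N + \sum_(k < K) G k.+1.
  by rewrite big_ord_recl.
by rewrite big_ord_recr /=; lra.
Qed.

(** By detailed balance and a shift of index, the terms on neighbouring edges return to the edge
    [k], whose total factor becomes [1 - eps (b k - b k.+1 + r k.+1 - r k)]. *)
Lemma bd_form_contract f : (forall k, (k <= K)%N -> 0 < f k) ->
  bd_form (bd_step f) <= (1 - eps * delta) * bd_form f.
Proof.
move=> f0.
pose a k := nu k * b k; pose q k := sqdist (f k.+1) (f k).
have a_ge0 k : (k <= K)%N -> 0 <= a k.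
  by move=> kK; rewrite mulr_ge0 ?bge0 // ltW // nu_gt0.
have e1 : \sum_(k < K) a k * (eps * b k.+1 * q k.+1) = \sum_(k < K) eps * r k * a k * q k.
  have -> : \sum_(k < K) eps * r k * a k * q k =
            \sum_(k < K) eps * r k.+1 * a k.+1 * q k.+1.
    rewrite (sum_ord_shift (fun k => eps * r k * a k * q k)).
    by rewrite /a bK r0 !(mulr0, mul0r); lra.
  apply: eq_bigr => k _.
  by rewrite /a -(balance (ltn_ord k)); ring.
have e2 : \sum_(k < K) a k * (eps * r k * sqdist (f k) (f k.-1)) =
          \sum_(k < K) eps * b k.+1 * a k * q k.
  have := sum_ord_shift (fun k => a k * (eps * r k * sqdist (f k) (f k.-1))).
  rewrite (_ : a K = 0) ?r0 ?/a ?bK !(mulr0, mul0r, addr0, subr0) // => <-.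
  by apply: eq_bigr => k _; rewrite /= /a -(balance (ltn_ord k)) /q; ring.
apply: (@le_trans _ _ (\sum_(k < K) a k * (eps * b k.+1 * q k.+1
    + eps * r k * sqdist (f k) (f k.-1) + (1 - eps * (b k + r k.+1)) * q k))).
  apply: ler_sum => k _; apply: ler_wpM2l; first by rewrite a_ge0 // ltnW.
  exact: bd_step_sqdist.
under eq_bigr => k _ do rewrite !mulrDr.
rewrite !big_split /= e1 e2 -!big_split /= mulr_sumr; apply: ler_sum => k _.
rewrite -/(a k) -/(q k) [leLHS](_ : _ = a k * q k *
  (1 - eps * (b k - b k.+1 + (r k.+1 - r k)))); last by ring.
rewrite [leRHS]mulrC; apply: ler_wpM2l.
  by rewrite mulr_ge0 ?sqdist_ge0 // a_ge0 // ltnW.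
rewrite lerD2l lerN2; apply: ler_wpM2l; first exact: ltW.
have := r_incr (ltn_ord k); have := b_decr (ltn_ord k); lra.
Qed.

Lemma bd_form_double f :
  \sum_(k < K.+1) nu k * (b k * sqdist (f k.+1) (f k) + r k * sqdist (f k.-1) (f k))
  = 2 * bd_form f.
Proof.
under eq_bigr => k _ do rewrite mulrDr.
rewrite big_split /= [X in X + _]big_ord_recr /= bK mul0r mulr0 addr0.
rewrite [X in _ + X]big_ord_recl /= r0 mul0r mulr0 add0r.
rewrite mulr2n mulrDl !mul1r; congr (_ + _); apply: eq_bigr => k _.
  by rewrite mulrA.
by rewrite /bump /= add0n !add1n mulrA balance // sqdistC.
Qed.

Lemma bd_entropy_step f : (forall k, (k <= K)%N -> 0 < f k) ->
  Ent f - Ent (bd_step f) <= 10 * ln T * eps * bd_form f.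
Proof.
move=> f0.
rewrite /Ent /entropy !big_mkord bd_stationary.
pose phi (x : R) := x * ln x.
set S := _ * ln _.
(* Stationarity applied to [phi \o f] localizes the loss: each summand is the entropy of [f] under
   the transition law from [k]. *)
have -> : \sum_(k < K.+1) nu k * (f k * ln (f k)) - S
    - (\sum_(k < K.+1) nu k * (bd_step f k * ln (bd_step f k)) - S)
  = \sum_(k < K.+1) nu k * (bd_step (phi \o f) k - bd_step f k * ln (bd_step f k)).
  rewrite -[X in X - S](bd_stationary (phi \o f)).
  under [RHS]eq_bigr => k _ do rewrite mulrBr.
  by rewrite [RHS]sumrB; lra.
have -> : 10 * ln T * eps * bd_form f = 5 * ln T * eps * (2 * bd_form f) by ring.
rewrite -bd_form_double mulr_sumr; apply: ler_sum => k _.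
rewrite mulrCA; apply: ler_wpM2l; first by rewrite ltW // nu_gt0 // -ltnS.
have kK : (k <= K)%N by rewrite -ltnS.
have fk := f0 _ kK.
have fkp : 0 < f k.-1 by apply: f0; apply: leq_trans (leq_pred _) kK.
have e0 := ltW eps_gt0.
(* [f K.+1] may fail to be positive; as its weight is [b K = 0], the value 1 can stand for it. *)
pose g := if (k < K)%N then f k.+1 else 1.
have g0 : 0 < g by rewrite /g; case: ifPn => // /f0.
have gE (F : R -> R) : b k * F g = b k * F (f k.+1).
  rewrite /g; case: ltnP => // Kk; have -> : k = K :> nat by apply/eqP; rewrite eqn_leq kK.
  by rewrite bK !mul0r.
have p1 : 0 <= eps * b k by rewrite mulr_ge0 // bge0.
have p2 : 0 <= eps * r k by rewrite mulr_ge0 // r_ge0.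
have p1T : eps * b k = 0 \/ 1 <= T * (eps * b k).
  move: kK; rewrite leq_eqVlt => /predU1P[->|/birthT]; last by right.
  by left; rewrite bK mulr0.
have p2T : eps * r k = 0 \/ 1 <= T * (eps * r k).
  case: (nat_of_ord k) kK => [|j] jK; first by left; rewrite r0 mulr0.
  by right; apply: deathT.
have E : bd_step f k = eps * b k * g + eps * r k * f k.-1 +
         (1 - eps * (b k + r k)) * f k.
  by rewrite -[eps * b k * g]mulrA (gE id) /bd_step /=; ring.
have p_sum : eps * b k + eps * r k + (1 - eps * (b k + r k)) = 1 by ring.
(* The centre [sqrt (f k)] removes the atom of staying put, so that only the edges at [k] remain. *)
have := @entropy_three_atoms R T _ _ _ _ _ _ (Num.sqrt (f k)) _ T4 p1 p1T p2 p2T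
  (stay_ge0 kK) (or_intror (stayT kK)) p_sum g0 fkp fk E.
rewrite -!/(sqdist _ _) sqdistxx mulr0 addr0.
rewrite -[eps * b k * (g * ln g)]mulrA (gE phi) -[eps * b k * sqdist g _]mulrA.
rewrite (gE (fun x => sqdist x (f k))) => h.
have -> : bd_step (phi \o f) k = eps * (b k * phi (f k.+1)) + eps * r k * (f k.-1 * ln (f k.-1))
  + (1 - eps * (b k + r k)) * (f k * ln (f k)) by rewrite /bd_step /phi /=; ring.
apply: le_trans h _; lra.
Qed.

(* The constant depends on the bounds of [f], which [bd_step] preserves: the
   entropy therefore tends to 0 along the iterates of [bd_step]. *)
Lemma bd_entropy_le f mu U : 0 < mu -> (forall k, (k <= K)%N -> mu <= f k <= U) ->
  Ent f <= (\sum_(k < K.+1) nu k) * (4 * U / mu) * 2 ^+ K * (\sum_(k < K) (nu k * b k)^-1) *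
    bd_form f.
Proof.
move=> mu0 fb.
have f0 k : (k <= K)%N -> 0 < f k by move=> /fb /andP[+ _]; apply: lt_le_trans.
pose c := f 0%N; have c0 : 0 < c by apply: f0.
have cmu : mu <= c by have /andP[] := fb 0%N isT.
have U0 : 0 < U by have /andP[_] := fb 0%N isT; apply: lt_le_trans.
have a0 (k : 'I_K) : 0 < nu k * b k by rewrite mulr_gt0 ?b_gt0 // nu_gt0 // ltnW.
have q_le (j : 'I_K) : sqdist (f j.+1) (f j) <= (nu j * b j)^-1 * bd_form f.
  rewrite ler_pdivlMl //.
  rewrite /bd_form (bigD1 j) //= lerDl sumr_ge0 // => i _.
  by rewrite mulr_ge0 ?sqdist_ge0 // ltW.
set V := \sum_(k < K) (nu k * b k)^-1.
(* Follows the path from 0 to [k]; each edge doubles the constant by [(a + b)^2 <= 2 a^2 + 2 b^2].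
   Any finite constant is good enough here. *)
have dist k : (k <= K)%N -> sqdist (f k) c <= 2 ^+ k * \sum_(j < K | (j < k)%N) (nu j * b j)^-1 * bd_form f.
  elim: k => [|k IH] kK; first by rewrite big1 ?mulr0 ?sqdistxx // => ? /andP[].
  have /IH h : (k <= K)%N by apply: ltnW.
  have := q_le (Ordinal kK) => /= h2.
  have h3 : sqdist (f k.+1) c <= 2 * sqdist (f k.+1) (f k) + 2 * sqdist (f k) c.
    rewrite /sqdist; set x := Num.sqrt _; set y := Num.sqrt _; set z := Num.sqrt _.
    rewrite -subr_ge0.
    have -> : 2 * (x - z) ^+ 2 + 2 * (z - y) ^+ 2 - (x - y) ^+ 2 = (x - z - (z - y)) ^+ 2 by ring.
    exact: sqr_ge0.
  rewrite (bigD1 (Ordinal kK)) //= exprS.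
  have -> : \sum_(i < K | (i < k.+1)%N && (i != Ordinal kK)) (nu i * b i)^-1 * bd_form f =
     \sum_(j < K | (j < k)%N) (nu j * b j)^-1 * bd_form f.
    by apply: eq_bigl => i; rewrite -val_eqE /= ltnS andbC -ltn_neqAle.
  have h4 : 1 <= 2 ^+ k :> R by rewrite exprn_ege1 // ler1n.
  have h5 : (nu k * b k)^-1 * bd_form f <= 2 ^+ k * ((nu k * b k)^-1 * bd_form f).
    by rewrite ler_peMl //; apply: le_trans h2; apply: sqdist_ge0.
  by rewrite -mulrA mulrDr mulrDr; lra.
have dist' k : (k <= K)%N -> sqdist (f k) c <= 2 ^+ K * V * bd_form f.
  move=> kK; apply: le_trans (dist k kK) _.
  rewrite -mulrA; apply: ler_pM; rewrite ?exprn_ge0 //.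
  - by apply: sumr_ge0 => j _; apply: le_trans (q_le j); apply: sqdist_ge0.
  - by rewrite ler_weXn2l // ler1n.
  rewrite /V mulr_suml [leRHS](bigID (fun j : 'I_K => (j < k)%N)) /= lerDl.
  by apply: sumr_ge0 => j _; apply: le_trans (q_le j); apply: sqdist_ge0.
rewrite /Ent /entropy !big_mkord.
set S := \sum_(k < K.+1) nu k * f k; set Z := \sum_(k < K.+1) nu k.
have Z0 : 0 < Z.
  rewrite /Z big_ord_recl ltr_wpDr ?nu_gt0 // sumr_ge0 // => i _.
  by rewrite ltW // nu_gt0 // -ltnS.
have S0 : 0 < S.
  rewrite /S big_ord_recl ltr_wpDr ?mulr_gt0 ?nu_gt0 // sumr_ge0 // => i _.
  by rewrite mulr_ge0 // ltW ?nu_gt0 ?f0 // -ltnS.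
(* Variational form of the entropy: putting a constant [c] in place of the mean [S / Z] can only
   increase the value. *)
have h1 : - (S * ln (S / Z)) <= - (S * ln c) - S + Z * c.
  have : ln (Z * c / S) <= Z * c / S - 1 by apply: ln_le_sub1; rewrite divr_gt0 ?mulr_gt0.
  rewrite !ln_div ?lnM ?posrE ?mulr_gt0 // => h.
  have := ler_wpM2l (ltW S0) h.
  have -> : S * (Z * c / S - 1) = Z * c - S by field; rewrite gt_eqF.
  lra.
apply: (@le_trans _ _ (\sum_(k < K.+1) nu k * (f k * ln (f k) - f k * ln c - f k + c))).
  have -> : \sum_(k < K.+1) nu k * (f k * ln (f k) - f k * ln c - f k + c)
    = \sum_(k < K.+1) nu k * (f k * ln (f k)) - S * ln c - S + Z * c.
    rewrite /S /Z !mulr_suml -!sumrB -big_split /=; apply: eq_bigr => k _; ring.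
  lra.
have -> : Z * (4 * U / mu) * 2 ^+ K * V * bd_form f =
  Z * (2 ^+ K * V * bd_form f * (4 * U) / mu) by ring.
rewrite mulr_suml; apply: ler_sum => k _.
have kK : (k <= K)%N by rewrite -ltnS.
apply: ler_wpM2l; first by rewrite ltW ?nu_gt0.
have fk := f0 _ kK; have /andP[_ fU] := fb _ kK.
(* Relative entropy is at most the chi-square distance. *)
have hl : f k * ln (f k) - f k * ln c - f k + c <= (f k - c) ^+ 2 / c.
  have : ln (f k / c) <= f k / c - 1 by apply: ln_le_sub1; rewrite divr_gt0.
  rewrite ln_div ?posrE // => /(ler_wpM2l (ltW fk)).
  have -> : (f k - c) ^+ 2 / c = f k * (f k / c - 1) - f k + c by field; rewrite gt_eqF.
  lra.
apply: le_trans hl _.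
have -> : (f k - c) ^+ 2 = sqdist (f k) c * (Num.sqrt (f k) + Num.sqrt c) ^+ 2.
  rewrite /sqdist -exprMn; congr (_ ^+ 2).
  by rewrite -subr_sqr !sqr_sqrtr // ltW.
have hs : (Num.sqrt (f k) + Num.sqrt c) ^+ 2 <= 4 * U.
  have cU : c <= U by have /andP[] := fb 0%N isT.
  have := sqr_sqrtr (ltW fk); have := sqr_sqrtr (ltW c0).
  have := sqr_ge0 (Num.sqrt (f k) - Num.sqrt c).
  rewrite sqrrB sqrrD !mulr2n; lra.
have h2 := ler_pM (sqdist_ge0 _ _) (sqr_ge0 _) (dist' _ kK) hs.
apply: ler_pM h2 _; first by rewrite mulr_ge0 ?sqdist_ge0 ?sqr_ge0.
  by rewrite invr_ge0 ltW.
by rewrite lef_pV2 ?posrE.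
Qed.

Let bd_iter n f := iter n bd_step f.

(** [A] is chosen so that the entropy lost in a step is paid by the decrease of [A * bd_form]. Hence
    [Ent - A * bd_form] never decreases along the iterates, while a geometric sequence tending to 0
    bounds it from above. *)
Lemma bd_log_sobolev f : (forall k, (k <= K)%N -> 0 < f k) ->
  Ent f <= 10 * ln T / delta * bd_form f.
Proof.
move=> f0; set A := 10 * ln T / delta.
have lT : 0 <= ln T by apply: ln_ge0; apply: le_trans T4; rewrite ler1n.
have A0 : 0 <= A by rewrite divr_ge0 ?mulr_ge0 // ltW.
have [mu [U [mu0 fb]]] : exists mu U, 0 < mu /\ forall k, (k <= K)%N -> mu <= f k <= U.
  clear A0 A lT; elim: K f0 => [|j IH] f0.
    exists (f 0%N), (f 0%N); split; first exact: f0.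
    by move=> k; rewrite leqn0 => /eqP ->; rewrite lexx.
  case: IH => [k kj|mu [U [mu0 fb]]]; first by apply: f0; apply: leq_trans kj _.
  exists (Num.min mu (f j.+1)), (Num.max U (f j.+1)); split.
    by rewrite lt_min mu0 f0.
  move=> k; rewrite leq_eqVlt => /predU1P[->|/fb /andP[h1 h2]].
    by rewrite ge_min le_max lexx !orbT.
  by rewrite ge_min le_max h1 h2.
have bounds n k : (k <= K)%N -> mu <= bd_iter n f k <= U.
  elim: n k => [|n IH] k kK; first exact: fb.
  by rewrite /bd_iter iterS; apply: bd_step_bounds.
have pos n k : (k <= K)%N -> 0 < bd_iter n f k.
  by move=> /(bounds n) /andP[+ _]; apply: lt_le_trans.
pose q := 1 - eps * delta.
(* On a single state the hypotheses do not force [eps * delta <= 1]; both sides are 0 there. *)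
have [K0|K0] := posnP K.
  have -> : bd_form f = 0 by rewrite /bd_form K0 big_ord0.
  rewrite mulr0 /Ent K0 /entropy !big_mkord !big_ord1.
  have n0 : nu 0%N != 0 by rewrite gt_eqF // nu_gt0.
  have -> : nu 0%N * f 0%N / nu 0%N = f 0%N by field.
  by rewrite mulrA subrr.
have q0 : 0 <= q.
  have := eps_couple K0; have := r_incr K0; rewrite r0 add0r => h1 h2.
  rewrite subr_ge0; apply: le_trans h2; apply: ler_wpM2l; first exact: ltW.
  by rewrite ler_wpDl // bge0.
have q1 : q < 1 by rewrite ltrBlDr ltrDl mulr_gt0.
have decay n : bd_form (bd_iter n f) <= q ^+ n * bd_form f.
  elim: n => [|n IH]; first by rewrite expr0 mul1r.
  rewrite /bd_iter iterS exprS -mulrA.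
  apply: le_trans (bd_form_contract (pos n)) _.
  exact: ler_wpM2l.
have mono n : Ent f - A * bd_form f <= Ent (bd_iter n f) - A * bd_form (bd_iter n f).
  elim: n => [|n IH]; first by [].
  apply: le_trans IH _; rewrite /bd_iter iterS -/(bd_iter n f).
  have h1 := bd_entropy_step (pos n).
  have h2 := ler_wpM2l A0 (bd_form_contract (pos n)).
  have h3 : A * (eps * delta) = 10 * ln T * eps.
    by rewrite /A; field; rewrite gt_eqF.
  have h4 : A * ((1 - eps * delta) * bd_form (bd_iter n f)) =
     A * bd_form (bd_iter n f) - 10 * ln T * eps * bd_form (bd_iter n f).
    by rewrite -h3; ring.
  lra.
set C := (\sum_(k < K.+1) nu k) * (4 * U / mu) * 2 ^+ K * (\sum_(k < K) (nu k * b k)^-1).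
have U0 : 0 < U by have /andP[] := fb 0%N isT; move=> h1 h2; apply: lt_le_trans (le_trans h1 h2).
have C0 : 0 <= C.
  rewrite !mulr_ge0 ?invr_ge0 ?exprn_ge0 ?(ltW U0) ?(ltW mu0) //; apply: sumr_ge0 => k _.
    by rewrite ltW // nu_gt0 // -ltnS.
  by rewrite invr_ge0 ltW // mulr_gt0 ?b_gt0 // nu_gt0 // ltnW.
have bound n : Ent f - A * bd_form f <= C * bd_form f * q ^+ n.
  apply: le_trans (mono n) _.
  have h := bd_entropy_le mu0 (bounds n).
  have h1 := ler_wpM2l C0 (decay n).
  have : 0 <= A * bd_form (bd_iter n f) by rewrite mulr_ge0 ?bd_form_ge0.
  by rewrite -[C * _ * _]mulrA [_ * q ^+ n]mulrC; move: h; rewrite -/C; lra.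
rewrite -subr_le0.
have cv : (C * bd_form f * q ^+ n @[n --> \oo] --> (0 : R))%classic.
  by apply: cvg_geometric; rewrite ger0_norm.
by apply: (ler_cvg_to (cvg_cst _) cv); apply: nearW.
Qed.
End BirthDeath.

(** * Configurations and weights *)

Section Configurations.
Variables (R : realType) (I : finType).
Notation cfg := {ffun I -> nat}.
Implicit Types (x y z : cfg) (i j : I) (B : {set I}) (k l K : nat).

Definition cadd x i (l : nat) : cfg := [ffun k => (x k + (k == i) * l)%N].
Definition csub x i : cfg := [ffun k => (x k - (k == i))%N].

(** Occupations are unbounded naturals, so that systems of all sizes share one type; the bound [k]
    serves only to list the configurations with [k] particles. *)
Definition states B (k : nat) : seq cfg :=
  [seq x : cfg <- undup [seq ([ffun i => val (t i)] : cfg) | t : {ffun I -> 'I_k.+1}]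
     | (\sum_i x i == k)%N && [forall i, (i \in B) || (x i == 0)%N]].

Lemma mem_states B k x :
  (x \in states B k) = (\sum_i x i == k)%N && [forall i, (i \in B) || (x i == 0)%N].
Proof.
rewrite mem_filter; case: eqP => //= sx.
case: forallP => //= _.
rewrite mem_undup; apply/mapP; exists [ffun i => inord (x i)]; first by rewrite mem_enum.
apply/ffunP => i; rewrite !ffunE inordK // ltnS -sx.
by rewrite (bigD1 i) //= leq_addr.
Qed.

Lemma states_uniq B k : uniq (states B k).
Proof. by rewrite filter_uniq // undup_uniq. Qed.

Lemma csub_cadd x i : csub (cadd x i 1) i = x.
Proof. by apply/ffunP => k; rewrite !ffunE muln1 addnK. Qed.

Lemma cadd_csub x i : (0 < x i)%N -> cadd (csub x i) i 1 = x.
Proof.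
move=> xi; apply/ffunP => k; rewrite !ffunE muln1 subnK //.
by case: eqP => // ->.
Qed.

Lemma caddC x i j k l : cadd (cadd x i k) j l = cadd (cadd x j l) i k.
Proof. by apply/ffunP => a; rewrite !ffunE addnAC. Qed.

Lemma caddD x i k l : cadd (cadd x i k) i l = cadd x i (k + l)%N.
Proof. by apply/ffunP => a; rewrite !ffunE mulnDr addnA. Qed.

Lemma sum_cadd x i l : (\sum_k cadd x i l k = \sum_k x k + l)%N.
Proof.
under eq_bigr => k _ do rewrite ffunE.
rewrite big_split /=; congr addn; rewrite (bigD1 i) //= eqxx mul1n big1 ?addn0 //.
by move=> k /negbTE ->.
Qed.

Lemma mem_cadd B k x i l : i \in B -> x \in states B k -> cadd x i l \in states B (k + l)%N.
Proof.
move=> iB; rewrite !mem_states sum_cadd => /andP[/eqP -> /forallP h].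
rewrite eqxx; apply/forallP => j; rewrite ffunE; have := h j.
have [->|_] := eqVneq j i; first by rewrite iB.
by rewrite mul0n addn0.
Qed.

Lemma mem_cadd1 B k x i : i \in B -> x \in states B k -> cadd x i 1 \in states B k.+1.
Proof. by move=> iB /(mem_cadd 1 iB); rewrite addn1. Qed.

Lemma mem_cadd' B k x i l : i \in B -> (l <= k)%N ->
  x \in states (B :\ i) (k - l)%N -> cadd x i l \in states B k.
Proof.
move=> iB lk xs; rewrite -(subnK lk); apply: mem_cadd => //.
move: xs; rewrite !mem_states => /andP[-> /forallP h]; apply/forallP => j.
by have := h j; rewrite in_setD1; case: (j \in B); rewrite ?andbF.
Qed.

Lemma mem_states_notin B k x i : x \in states (B :\ i) k -> x i = 0%N.
Proof. by rewrite mem_states => /andP[_ /forallP/(_ i)]; rewrite in_setD1 eqxx => /eqP. Qed.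

Lemma mem_csub B k x i : i \in B -> (0 < x i)%N -> x \in states B k.+1 ->
  csub x i \in states B k.
Proof.
move=> iB xi; rewrite !mem_states => /andP[/eqP sx /forallP h]; apply/andP; split.
  by have := sum_cadd (csub x i) i 1; rewrite cadd_csub // sx addn1 => -[->].
apply/forallP => j; rewrite ffunE; have := h j.
by case: (j \in B) => //= /eqP ->.
Qed.

Lemma states_pos B k x : (0 < k)%N -> x \in states B k -> exists2 i, i \in B & (0 < x i)%N.
Proof.
move=> k0; rewrite mem_states => /andP[/eqP sx /forallP h].
have [/existsP[i xi]|/existsPn h0] := boolP [exists i, (0 < x i)%N].
  by exists i => //; have := h i; rewrite eqn0Ngt xi orbF.
move: k0; rewrite -sx big1 // => i _.
by have := h0 i; rewrite -eqn0Ngt => /eqP.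
Qed.

Lemma states0_eq B x y : x \in states B 0 -> y \in states B 0 -> x = y.
Proof.
rewrite !mem_states !sum_nat_eq0 => /andP[/forallP hx _] /andP[/forallP hy _].
apply/ffunP => i; have := hx i; have := hy i => /=.
by move=> /eqP -> /eqP ->.
Qed.

Lemma states1_eq i k x y : x \in states [set i]%SET k -> y \in states [set i]%SET k -> x = y.
Proof.
have h z : z \in states [set i]%SET k -> z = [ffun j => ((j == i) * k)%N].
  rewrite mem_states => /andP[/eqP <- /forallP h]; apply/ffunP => j; rewrite ffunE.
  have h0 a : a != i -> z a = 0%N.
    by move=> /negbTE ai; have := h a; rewrite finset.in_set1 ai => /eqP.
  have [->|/h0 //] := eqVneq j i.
  by rewrite mul1n (bigD1 i) //= big1 ?addn0 // => a /h0.
by move=> /h -> /h ->.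
Qed.

(** Move one particle of [x] to a site [j] occupied in [x']. Both then have a particle at [j], which
    is frozen while the induction treats the others. *)
Lemma states_connected (S : Type) B k (h : cfg -> S) :
  (forall y i j, y \in states B k -> i \in B -> j \in B -> h (cadd y i 1) = h (cadd y j 1)) ->
  forall x x', x \in states B k.+1 -> x' \in states B k.+1 -> h x = h x'.
Proof.
elim: k h => [|k IH] h hB x x' xs x's.
  have [i iB xi] := states_pos (ltn0Sn _) xs.
  have [j jB xj] := states_pos (ltn0Sn _) x's.
  rewrite -(cadd_csub xi) -(cadd_csub xj).
  rewrite (states0_eq (mem_csub iB xi xs) (mem_csub jB xj x's)).
  by apply: hB => //; apply: mem_csub.
have [i iB xi] := states_pos (ltn0Sn _) xs.
have [j jB xj] := states_pos (ltn0Sn _) x's.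
have ys := mem_csub iB xi xs; have zs := mem_csub jB xj x's.
rewrite -(cadd_csub xi) -(cadd_csub xj) (hB _ j i) //.
apply: (IH (fun z => h (cadd z i 1))) => // y a b yB aB bB.
rewrite (caddC y a) (caddC y b).
by rewrite -(hB _ a) ?(mem_cadd1 aB) // 1?(hB _ i b) ?mem_cadd1 // caddC (hB _ i a) ?mem_cadd1 // caddC.
Qed.

Variable r : I -> nat -> R.
Hypothesis r0 : forall i, r i 0%N = 0.
Hypothesis r_gt0 : forall i k, (0 < k)%N -> 0 < r i k.

Definition site_weight i k : R := \prod_(1 <= l < k.+1) (r i l)^-1.
Definition weight x : R := \prod_i site_weight i (x i).
Definition wsum B k (F : cfg -> R) : R := \sum_(x <- states B k) weight x * F x.
Definition Zpart B k : R := wsum B k (fun=> 1).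

Lemma site_weight_gt0 i k : 0 < site_weight i k.
Proof. by rewrite /site_weight big_nat; apply: prodr_gt0 => l /andP[l0 _]; rewrite invr_gt0 r_gt0. Qed.

Lemma site_weight0 i : site_weight i 0 = 1.
Proof. by rewrite /site_weight big_geq. Qed.

Lemma site_weightS i k : site_weight i k.+1 * r i k.+1 = site_weight i k.
Proof.
rewrite /site_weight big_nat_recr //= mulfVK // gt_eqF // r_gt0 //.
Qed.

Lemma weight_gt0 x : 0 < weight x.
Proof. by apply: prodr_gt0 => i _; apply: site_weight_gt0. Qed.

Lemma weight_cadd0 x i l : x i = 0%N -> weight (cadd x i l) = site_weight i l * weight x.
Proof.
move=> xi; rewrite /weight (bigD1 i) //= [in RHS](bigD1 i) //= xi site_weight0 mul1r.
rewrite ffunE eqxx mul1n xi add0n; congr (_ * _); apply: eq_bigr => j ji.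
by rewrite ffunE (negbTE ji) mul0n addn0.
Qed.

Lemma weight_cadd1 x i : weight (cadd x i 1) * r i (x i).+1 = weight x.
Proof.
rewrite /weight (bigD1 i) //= [in RHS](bigD1 i) //= ffunE eqxx muln1 addn1.
rewrite mulrAC site_weightS; congr (_ * _); apply: eq_bigr => j ji.
by rewrite ffunE (negbTE ji) mul0n addn0.
Qed.

Lemma eq_wsum B k F G : (forall x, x \in states B k -> F x = G x) -> wsum B k F = wsum B k G.
Proof. by move=> h; apply: eq_big_seq => x /h ->. Qed.

Lemma le_wsum B k F G : (forall x, x \in states B k -> F x <= G x) -> wsum B k F <= wsum B k G.
Proof.
move=> h; rewrite /wsum !big_seq; apply: ler_sum => x xs; apply: ler_wpM2l; last exact: h.
exact/ltW/weight_gt0.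
Qed.

Lemma wsum_ge0 B k F : (forall x, x \in states B k -> 0 <= F x) -> 0 <= wsum B k F.
Proof.
move=> h; rewrite /wsum big_seq; apply: sumr_ge0 => x xs.
by rewrite mulr_ge0 ?h // ltW ?weight_gt0.
Qed.

Lemma wsumZ B k c F : wsum B k (fun x => c * F x) = c * wsum B k F.
Proof. by rewrite /wsum mulr_sumr; apply: eq_bigr => x _; rewrite mulrCA. Qed.

Lemma wsum_sum B k (J : Type) (s : seq J) (P : pred J) (F : J -> cfg -> R) :
  wsum B k (fun x => \sum_(j <- s | P j) F j x) = \sum_(j <- s | P j) wsum B k (F j).
Proof.
rewrite /wsum exchange_big /=; apply: eq_bigr => x _.
by rewrite mulr_sumr.
Qed.

Lemma wsum_gt0 B k i F : i \in B -> (forall x, 0 < F x) -> 0 < wsum B k F.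
Proof.
move=> iB F0.
have xs : cadd [ffun=> 0%N] i k \in states B k.
  have := @mem_cadd B 0 [ffun=> 0%N] i k iB; rewrite add0n; apply.
  rewrite mem_states big1 => [|j _]; last by rewrite ffunE.
  by apply/forallP => j; rewrite ffunE orbT.
rewrite /wsum (perm_big _ (perm_to_rem xs)) /= big_cons ltr_pwDl ?mulr_gt0 ?weight_gt0 //.
by rewrite sumr_ge0 // => y _; rewrite mulr_ge0 // ltW ?weight_gt0.
Qed.

Lemma Zpart_gt0 B k i : i \in B -> 0 < Zpart B k.
Proof. by move=> iB; apply: wsum_gt0 iB _. Qed.

(** The rate [r j] cancels the last factor of the weight at [j]. This discrete integration by parts
    produces the mean rates and the Dirichlet forms. *)
Lemma wsum_ibp B k j F : j \in B ->
  wsum B k.+1 (fun x => r j (x j) * F x) = wsum B k (fun y => F (cadd y j 1)).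
Proof.
move=> jB; rewrite /wsum (bigID (fun x => (0 < x j)%N)) /= [X in _ + X]big1 ?addr0; last first.
  by move=> x; rewrite -eqn0Ngt => /eqP ->; rewrite r0 mul0r mulr0.
rewrite -big_filter.
have -> : \sum_(y <- states B k) weight y * F (cadd y j 1) =
  \sum_(x <- [seq cadd y j 1 | y <- states B k]) weight x * (r j (x j) * F x).
  rewrite big_map; apply: eq_bigr => y _; rewrite mulrA.
  by rewrite {2}/cadd ffunE eqxx muln1 addn1 weight_cadd1.
apply: perm_big; apply: uniq_perm; first by rewrite filter_uniq // states_uniq.
  rewrite map_inj_in_uniq ?states_uniq // => x y _ _ e.
  by rewrite -(csub_cadd x j) e csub_cadd.
move=> x; rewrite mem_filter; apply/andP/mapP => [[xj xs]|[y ys ->]].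
  by exists (csub x j); rewrite ?cadd_csub // mem_csub.
by rewrite mem_cadd1 // ffunE eqxx muln1 addn1.
Qed.

Lemma wsum_ibp0 B j F : wsum B 0 (fun x => r j (x j) * F x) = 0.
Proof.
rewrite /wsum big_seq big1 // => x; rewrite mem_states sum_nat_eq0 => /andP[/forallP h _].
by have /= /eqP -> := h j; rewrite r0 mul0r mulr0.
Qed.

(** The weight is a product over sites, so given [l] particles at [i] the other sites carry the same
    kind of measure with [K - l] particles. This is what permits induction on the sites. *)
Lemma wsum_cond B K i F : i \in B ->
  wsum B K F = \sum_(l < K.+1) site_weight i l *
                 wsum (B :\ i) (K - l)%N (fun z => F (cadd z i l)).
Proof.
move=> iB; rewrite /wsum (partition_big (fun x : cfg => inord (x i) : 'I_K.+1) xpredT) //=.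
apply: eq_bigr => l _; rewrite mulr_sumr.
have lK : (l <= K)%N by rewrite -ltnS.
have -> : \sum_(z <- states (B :\ i) (K - l)%N) site_weight i l * (weight z * F (cadd z i l))
  = \sum_(x <- [seq cadd z i l | z <- states (B :\ i) (K - l)%N]) weight x * F x.
  rewrite big_map big_seq [RHS]big_seq; apply: eq_bigr => z /mem_states_notin zi.
  by rewrite weight_cadd0 // mulrA.
rewrite -big_filter; apply: perm_big; apply: uniq_perm.
- by rewrite filter_uniq // states_uniq.
- rewrite map_inj_in_uniq ?states_uniq // => x y /mem_states_notin xi /mem_states_notin yi e.
  apply/ffunP => k; have [->|ki] := eqVneq k i; first by rewrite xi yi.
  by have /ffunP/(_ k) := e; rewrite !ffunE (negbTE ki) !addn0.
move=> x; rewrite mem_filter; apply/andP/mapP => [[/eqP xi xs]|[z zs ->]]; last first.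
  rewrite mem_cadd' //; split=> //; apply/eqP/val_inj => /=.
  by rewrite ffunE (mem_states_notin zs) eqxx mul1n add0n inordK.
have xil : x i = l :> nat.
  rewrite -xi inordK // ltnS; move: xs; rewrite mem_states => /andP[/eqP <- _].
  by rewrite (bigD1 i) //= leq_addr.
pose z : cfg := [ffun k => if k == i then 0%N else x k].
have xz : x = cadd z i l.
  apply/ffunP => k; rewrite !ffunE; case: eqP => [->|]; last by rewrite addn0.
  by rewrite mul1n add0n.
exists z => //; move: xs; rewrite !mem_states {1}xz sum_cadd => /andP[/eqP sz /forallP h].
have -> : (K - l = \sum_k z k)%N by apply/eqP; rewrite -(eqn_add2r l) subnK // sz.
rewrite eqxx; apply/forallP => j; rewrite in_setD1 ffunE.
have := h j; have [_|_] := eqVneq j i; first by rewrite eqxx orbT.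
by [].
Qed.
End Configurations.

(** * Coupling through a second-class particle *)

(** The constant vector shows that [A] is singular, which gives a signed left null vector [v]. By
    the triangle inequality [|v| A] is nonnegative, and its entries sum to 0, so [|v|] is null as
    well. *)
Lemma stationary_distribution (R : realFieldType) (T : eqType) (s : seq T)
    (A : T -> T -> R) : uniq s -> s != [::] ->
  (forall x, x \in s -> \sum_(y <- s) A x y = 0) ->
  (forall x y, x \in s -> y \in s -> x != y -> 0 <= A x y) ->
  exists v : T -> R, [/\ forall x, 0 <= v x, \sum_(x <- s) v x = 1 &
    forall y, y \in s -> \sum_(x <- s) v x * A x y = 0].
Proof.
move=> us s0 A0 A_ge0.
pose t := tnth (in_tuple s).
have t_inj : injective t by apply/tuple_uniqP.
have ts i : t i \in s by apply: mem_tnth.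
have sumE (F : T -> R) : \sum_(x <- s) F x = \sum_i F (t i).
  by rewrite (big_tnth _ _ s).
pose M : 'M[R]_(size s) := \matrix_(i, j) A (t i) (t j).
have [i0 _] : exists i0 : 'I_(size s), True.
  by case: (s) s0 => // a s' _; exists ord0.
have /det0P[v v0 vM] : \det M == 0.
  rewrite -[_ == 0]negbK -unitfE -unitmxE; apply/negP => Mu.
  have M1 : M *m const_mx 1 = 0 :> 'cV_(size s).
    apply/matrixP => i j; rewrite !mxE -[RHS](A0 (t i)) // sumE.
    by apply: eq_bigr => k _; rewrite !mxE mulr1.
  have /matrixP/(_ i0 0) : const_mx 1 = 0 :> 'cV[R]_(size s).
    by rewrite -(mulKmx Mu (const_mx 1)) M1 mulmx0.
  by rewrite !mxE => /eqP; rewrite oner_eq0.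
pose c := \sum_i `|v 0 i|.
have c0 : 0 < c.
  rewrite lt_def sumr_ge0 ?andbT //; apply: contra v0 => /eqP c0.
  apply/eqP/matrixP => a i; rewrite ord1 mxE; apply/eqP; rewrite -normr_eq0.
  by apply/eqP; apply: (psumr_eq0P _ c0).
pose G j := \sum_i `|v 0 i| * A (t i) (t j).
have G_ge0 j : 0 <= G j.
  rewrite /G (bigD1 j) //=.
  have /matrixP/(_ 0 j) := vM; rewrite !mxE (bigD1 j) //= mxE => h.
  have Ajj : A (t j) (t j) <= 0.
    have := A0 _ (ts j); rewrite sumE (bigD1 j) //= => /eqP; rewrite addr_eq0 => /eqP ->.
    by rewrite oppr_le0 sumr_ge0 // => i ij; rewrite A_ge0 // (inj_eq t_inj) eq_sym.
  have off : \sum_(i | i != j) `|v 0 i| * A (t i) (t j) =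
             \sum_(i | i != j) `|v 0 i * A (t i) (t j)|.
    apply: eq_bigr => i ij; rewrite normrM [`|A _ _|]ger0_norm // A_ge0 //.
    by rewrite (inj_eq t_inj).
  have diag : `|v 0 j| * A (t j) (t j) = - `|\sum_(i | i != j) v 0 i * A (t i) (t j)|.
    move/eqP: h; rewrite addrC addr_eq0 => /eqP h.
    rewrite (eq_bigr (fun i => v 0 i * M i j)) => [|i _]; last by rewrite mxE.
    by rewrite h normrN normrM [`|A _ _|]ler0_norm // mulrN opprK.
  by rewrite off diag addrC subr_ge0 ler_norm_sum.
have G_sum : \sum_j G j = 0.
  rewrite /G exchange_big big1 // => i _.
  by rewrite -mulr_sumr -(sumE (A (t i))) A0 ?mulr0.
have G0 j : G j = 0 by apply: (psumr_eq0P (fun j _ => G_ge0 j) G_sum).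
(* Carries the vector from indices back to [T]; as [t] is injective, at most one index
   contributes. *)
pose w x := \sum_(i | t i == x) `|v 0 i| / c.
have wE (F : T -> R) : \sum_(x <- s) w x * F x = \sum_i `|v 0 i| / c * F (t i).
  rewrite sumE; apply: eq_bigr => i _; rewrite /w (big_pred1 i) // => j /=.
  exact: inj_eq.
exists w; split.
- by move=> x; apply: sumr_ge0 => i _; rewrite divr_ge0 // ltW.
- have := wE (fun=> 1); under eq_bigr => x _ do rewrite mulr1; move=> ->.
  by under eq_bigr => i _ do rewrite mulr1; rewrite -mulr_suml divff // gt_eqF.
move=> y ys; have [j ->] : exists j, y = t j.
  by have /tnthP[j ->] : y \in in_tuple s by []; exists j.
rewrite (wE (fun x => A x (t j))).
have -> : \sum_i `|v 0 i| / c * A (t i) (t j) = c^-1 * G j.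
  by rewrite mulr_sumr; apply: eq_bigr => i _; ring.
by rewrite G0 mulr0.
Qed.

Section Coupling.
Variables (R : realType) (I : finType) (r : I -> nat -> R).
Notation cfg := {ffun I -> nat}.
Hypothesis r0 : forall i, r i 0%N = 0.
Hypothesis r_gt0 : forall i k, (0 < k)%N -> 0 < r i k.
Variables (delta Delta : R).
Hypothesis delta_gt0 : 0 < delta.
Hypothesis r_incr : forall i k, delta <= r i k.+1 - r i k <= Delta.
Implicit Types (x y z : cfg) (i j l : I) (B : {set I}) (k : nat) (h u : cfg -> R).
Local Notation wt := (weight r).

Let r_ge0 i k : 0 <= r i k.
Proof. by case: k => [|k]; [rewrite r0|rewrite ltW // r_gt0]. Qed.

Definition cgen B h x : R :=
  \sum_(i in B) \sum_(l in B) r i (x i) * (h (cadd (csub x i) l 1) - h x).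

Lemma cgen0 B h x : x \in states B 0 -> cgen B h x = 0.
Proof.
rewrite mem_states sum_nat_eq0 => /andP[/forallP x0 _].
by rewrite /cgen big1 // => i _; rewrite big1 // => l _; have /= /eqP -> := x0 i; rewrite r0 mul0r.
Qed.

(** After integration by parts, [k] particles are fixed and one sits at [i] or [l]; exchanging the
    names [i] and [l] symmetrizes the sum. *)
Lemma cgen_form B k u h :
  wsum r B k.+1 (fun x => u x * cgen B h x) =
  - (2^-1 * wsum r B k (fun y => \sum_(i in B) \sum_(l in B)
     (u (cadd y i 1) - u (cadd y l 1)) * (h (cadd y i 1) - h (cadd y l 1)))).
Proof.
have -> : wsum r B k.+1 (fun x => u x * cgen B h x) =
  \sum_(i in B) \sum_(l in B) wsum r B k.+1
     (fun x => r i (x i) * (u x * (h (cadd (csub x i) l 1) - h x))).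
  under eq_bigr => i _ do rewrite -wsum_sum.
  rewrite -wsum_sum; apply: eq_wsum => x _; rewrite /cgen mulr_sumr.
  by apply: eq_bigr => i _; rewrite mulr_sumr; apply: eq_bigr => l _; ring.
under eq_bigr => i iB do under eq_bigr => l lB do
  rewrite (wsum_ibp r0 r_gt0 k (fun x => u x * (h (cadd (csub x i) l 1) - h x)) iB).
under eq_bigr => i _ do rewrite -wsum_sum.
rewrite -wsum_sum -wsumZ -sumrN; apply: eq_bigr => y _.
rewrite -mulrN; congr (_ * _).
under eq_bigr => i _ do under eq_bigr => l _ do rewrite csub_cadd.
set S := LHS.
have S2 : S = \sum_(i in B) \sum_(l in B) u (cadd y l 1) * (h (cadd y i 1) - h (cadd y l 1)).
  by rewrite /S exchange_big.
have -> : \sum_(i in B) \sum_(l in B)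
     (u (cadd y i 1) - u (cadd y l 1)) * (h (cadd y i 1) - h (cadd y l 1)) = - (S + S).
  rewrite {1}S2 -big_split /= -sumrN; apply: eq_bigr => i _.
  by rewrite -big_split /= -sumrN; apply: eq_bigr => l _; ring.
by lra.
Qed.

(** Used for a density and its truncation, which vary in the same direction and so make every term
    of the form nonnegative. *)
Lemma cgen_le0 B k u h : (forall x y, 0 <= (u x - u y) * (h x - h y)) ->
  wsum r B k (fun x => u x * cgen B h x) <= 0.
Proof.
move=> uh; case: k => [|k].
  by rewrite /wsum big_seq big1 // => x xs; rewrite cgen0 // !mulr0.
rewrite cgen_form oppr_le0 mulr_ge0 ?invr_ge0 ?ler0n // wsum_ge0 // => y _.
by apply: sumr_ge0 => a _; apply: sumr_ge0 => b _.
Qed.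

(** Testing invariance against the density [u] itself makes its Dirichlet form vanish: moving one
    particle does not change [u], which is constant by connectedness. *)
Lemma cgen_invariant B k i (Q : cfg -> R) : i \in B ->
  (forall h, \sum_(x <- states B k) Q x * cgen B h x = 0) ->
  forall x, x \in states B k ->
    Q x = wt x * ((\sum_(y <- states B k) Q y) / Zpart r B k).
Proof.
move=> iB Qinv; pose u x := Q x / wt x.
have uQ x : Q x = wt x * u x by rewrite /u mulrCA divff ?mulr1 // gt_eqF // weight_gt0.
have uc x y : x \in states B k -> y \in states B k -> u x = u y.
  case: k Qinv => [|k] Qinv; first by move=> xs ys; rewrite (states0_eq xs ys).
  apply: states_connected => z a b zs aB bB.
  have := cgen_form B k u u.
  rewrite /wsum; under eq_bigr => ? _ do rewrite mulrA -uQ.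
  rewrite Qinv => /esym/eqP; rewrite oppr_eq0 mulf_eq0 invr_eq0 pnatr_eq0 /=.
  have sq_ge0 z' : 0 <= \sum_(i0 in B) \sum_(l in B)
     (u (cadd z' i0 1) - u (cadd z' l 1)) * (u (cadd z' i0 1) - u (cadd z' l 1)).
    by apply: sumr_ge0 => ? _; apply: sumr_ge0 => ? _; rewrite -expr2 sqr_ge0.
  rewrite psumr_eq0 => [|z' _]; last by rewrite mulr_ge0 // ltW // weight_gt0.
  move=> /allP/(_ z zs) /=; rewrite mulf_eq0 gt_eqF ?weight_gt0 //= => /eqP h.
  have h1 : \sum_(l in B) (u (cadd z a 1) - u (cadd z l 1)) * (u (cadd z a 1) - u (cadd z l 1)) = 0.
    apply: (psumr_eq0P _ h) => // ? _; apply: sumr_ge0 => ? _.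
    by rewrite -expr2 sqr_ge0.
  have sq l : l \in B -> 0 <= (u (cadd z a 1) - u (cadd z l 1)) * (u (cadd z a 1) - u (cadd z l 1)).
    by rewrite -expr2 sqr_ge0.
  by have /eqP := psumr_eq0P sq h1 bB; rewrite -expr2 sqrf_eq0 subr_eq0 => /eqP.
move=> x xs; rewrite uQ; congr (_ * _).
have Z0 : 0 < Zpart r B k by apply: Zpart_gt0 iB.
have -> : \sum_(y <- states B k) Q y = u x * Zpart r B k.
  rewrite /Zpart /wsum mulr_sumr !big_seq; apply: eq_bigr => y ys.
  by rewrite mulr1 uQ (uc x y) // mulrC.
by rewrite mulfK // gt_eqF.
Qed.

(* Generator of the zero-range process (complete graph on [B], jump rate 1 per
   target site) with one additional second-class particle at [j], so that [x]
   and [cadd x j 1] are both zero-range processes. *)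
Definition sgen B (F : cfg -> I -> R) x j : R :=
  cgen B (F^~ j) x + (r j (x j).+1 - r j (x j)) * \sum_(l in B) (F x l - F x j).

Lemma sgen_sum B (T : Type) (s : seq T) (c : T -> R) (F : T -> cfg -> I -> R) x j :
  sgen B (fun y l => \sum_(t <- s) c t * F t y l) x j = \sum_(t <- s) c t * sgen B (F t) x j.
Proof.
rewrite /sgen /cgen.
under [RHS]eq_bigr => t _ do rewrite mulrDr mulrCA.
rewrite [RHS]big_split /=; congr (_ + _).
  under [RHS]eq_bigr => t _ do rewrite mulr_sumr.
  rewrite [RHS]exchange_big /=; apply: eq_bigr => i _.
  under [RHS]eq_bigr => t _ do rewrite mulr_sumr.
  rewrite [RHS]exchange_big /=; apply: eq_bigr => l _.
  rewrite -sumrB mulr_sumr; apply: eq_bigr => t _; ring.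
rewrite -[RHS]mulr_sumr; congr (_ * _).
under [RHS]eq_bigr => t _ do rewrite mulr_sumr.
rewrite [RHS]exchange_big /=; apply: eq_bigr => l _.
by rewrite -sumrB; apply: eq_bigr => t _; ring.
Qed.

Lemma sgen_local B k (F F' : cfg -> I -> R) x j : x \in states B k -> j \in B ->
  (forall y l, y \in states B k -> l \in B -> F y l = F' y l) ->
  sgen B F x j = sgen B F' x j.
Proof.
move=> xs jB FF; rewrite /sgen; congr (_ + _ * _); last first.
  by apply: eq_bigr => l lB; rewrite !FF.
apply: eq_bigr => i iB; apply: eq_bigr => l lB.
have [xi|] := posnP (x i); first by rewrite xi r0 !mul0r.
case: k xs FF => [|k] xs FF xi.
  move: xs; rewrite mem_states sum_nat_eq0 => /andP[/forallP/(_ i) /=].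
  by rewrite (gtn_eqF xi).
by rewrite !FF // mem_cadd1 // mem_csub.
Qed.

(** The rate [r j (x j).+1] out of [j] splits into [r j (x j)] for the first-class particles and the
    increment for the second-class one; whichever of them jumps, the total configuration is the
    same. *)
Lemma cgen_cadd B h x j : j \in B -> cgen B h (cadd x j 1) =
  sgen B (fun y l => h (cadd y l 1)) x j.
Proof.
move=> jB; rewrite /sgen /cgen (bigD1 j) //= [in RHS](bigD1 j) //= addrAC.
congr (_ + _).
  rewrite mulr_sumr -big_split; apply: eq_bigr => l lB /=.
  rewrite csub_cadd ffunE eqxx muln1 addn1.
  have [xj|xj] := posnP (x j); first by rewrite xj r0 !mul0r add0r subr0.
  by rewrite caddC cadd_csub //; ring.
apply: eq_bigr => i /andP[iB ij]; apply: eq_bigr => l lB.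
rewrite ffunE (negbTE ij) mul0n addn0.
have [xi|xi] := posnP (x i); first by rewrite xi r0 !mul0r.
congr (_ * (h _ - _)); apply/ffunP => a; rewrite !ffunE !muln1.
have [->|_] := eqVneq a i; last by rewrite !subn0 addnAC.
by rewrite (negbTE ij) !addn0.
Qed.

(** The increments of [r] are positive, so the second-class particle has nonnegative jump rates and
    [sgen] is a generator on the finite list of pairs. *)
Lemma second_class_stationary B k i : i \in B ->
  exists p : cfg -> I -> R, [/\ forall x j, 0 <= p x j,
    \sum_(x <- states B k) \sum_(j in B) p x j = 1 &
    forall F, \sum_(x <- states B k) \sum_(j in B) p x j * sgen B F x j = 0].
Proof.
move=> iB.
pose s := [seq (x, j) | x <- states B k, j <- enum B].
have sE (F : cfg * I -> R) : \sum_(a <- s) F a = \sum_(x <- states B k) \sum_(j in B) F (x, j).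
  by rewrite big_allpairs; apply: eq_bigr => x _; rewrite big_enum.
have mem_s a : (a \in s) = (a.1 \in states B k) && (a.2 \in B).
  apply/allpairsP/andP => [[[x j] /= [xs jB ->]]|[xs jB]] /=.
    by rewrite -mem_enum.
  by exists a; rewrite mem_enum; case: a xs jB.
have us : uniq s by rewrite allpairs_uniq ?states_uniq ?enum_uniq // => -[? ?] [? ?].
pose d (b : cfg * I) y l : R := ((y, l) == b)%:R.
pose A (a b : cfg * I) := sgen B (d b) a.1 a.2.
have AE (F : cfg -> I -> R) a : a \in s -> sgen B F a.1 a.2 = \sum_(b <- s) F b.1 b.2 * A a b.
  rewrite mem_s => /andP[a1 a2]; rewrite -sgen_sum; apply: (sgen_local a1 a2) => y l ys lB.
  rewrite (bigD1_seq (y, l)) ?mem_s ?ys //= /d eqxx mulr1 big1 ?addr0 // => b.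
  by rewrite eq_sym => /negbTE ->; rewrite mulr0.
have s_neq0 : s != [::].
  have := Zpart_gt0 r_gt0 k iB; rewrite /Zpart /wsum.
  have : (_ : cfg * I) \in s -> s != [::] by move=> ?; case: (s).
  case E : (states B k) => [|x t]; first by rewrite big_nil ltxx.
  move=> h _; apply: (h (x, i)); rewrite mem_s /= iB E inE eqxx //.
have A_sum a : a \in s -> \sum_(b <- s) A a b = 0.
  move=> as_; under eq_bigr => b _ do rewrite -[A a b]mul1r.
  rewrite -(AE (fun _ _ => 1)) // /sgen /cgen.
  rewrite [X in _ * X]big1 => [|l _]; last by rewrite subrr.
  by rewrite mulr0 addr0 big1 // => l _; rewrite big1 // => l' _; rewrite subrr mulr0.
have A_ge0 a b : a \in s -> b \in s -> a != b -> 0 <= A a b.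
  move=> _ _ ab; rewrite /A /sgen /cgen /d.
  have -> : ((a.1, a.2) == b) = false by rewrite -surjective_pairing; apply/negbTE.
  apply: addr_ge0.
    apply: sumr_ge0 => l _; apply: sumr_ge0 => l' _.
    by rewrite mulr_ge0 // subr0 ler0n.
  apply: mulr_ge0; first by have /andP[+ _] := r_incr a.2 (a.1 a.2); have := delta_gt0; lra.
  by apply: sumr_ge0 => l _; rewrite subr0 ler0n.
have [v [v0 v1 vA]] := stationary_distribution us s_neq0 A_sum A_ge0.
exists (fun x j => v (x, j)); split=> //; first by rewrite -sE.
move=> F.
rewrite -(sE (fun a => v a * sgen B F a.1 a.2)).
rewrite big_seq; under eq_bigr => a as_ do rewrite AE // mulr_sumr.
rewrite -big_seq exchange_big /= big_seq big1 // => b bs.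
under eq_bigr => a _ do rewrite mulrCA.
by rewrite -mulr_sumr vA // mulr0.
Qed.

(** Under the stationary law of the pair, [x] and [cadd x j 1] are both stationary zero-range
    configurations, and [cgen_invariant] identifies their laws. The last clause turns sums against
    [p] into sums against the weights. *)
Lemma coupling B k i : i \in B ->
  exists p : cfg -> I -> R, [/\ forall x j, 0 <= p x j,
    forall h, \sum_(x <- states B k) \sum_(j in B) p x j * h x = wsum r B k h / Zpart r B k,
    forall h, \sum_(x <- states B k) \sum_(j in B) p x j * h (cadd x j 1) =
       wsum r B k.+1 h / Zpart r B k.+1 &
    forall x j, x \in states B k -> j \in B ->
       p x j <= Delta / (delta * #|B|%:R) * (wt x / Zpart r B k)].
Proof.
move=> iB; have [p [p0 p1 pinv]] := second_class_stationary k iB.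
have Z0 k' : 0 < Zpart r B k' by apply: Zpart_gt0 iB.
have d0 := delta_gt0.
have margX x : x \in states B k -> \sum_(j in B) p x j = wt x / Zpart r B k.
  move=> xs.
  have h : forall h, \sum_(x <- states B k) (\sum_(j in B) p x j) * cgen B h x = 0.
    move=> h; rewrite -[RHS](pinv (fun x _ => h x)); apply: eq_bigr => y _.
    rewrite mulr_suml; apply: eq_bigr => j _; rewrite /sgen [X in _ = _ * (_ + _ * X)]big1 ?mulr0 ?addr0 //.
    by move=> l _; rewrite subrr.
  by rewrite (cgen_invariant iB h xs) p1 mul1r.
have mX h : \sum_(x <- states B k) \sum_(j in B) p x j * h x = wsum r B k h / Zpart r B k.
  rewrite /wsum mulr_suml !big_seq; apply: eq_bigr => x xs.
  by rewrite -mulr_suml margX //; ring.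
exists p; split=> //.
- pose Q z := \sum_(x <- states B k) \sum_(j in B) p x j * (cadd x j 1 == z)%:R.
  have QE h : \sum_(z <- states B k.+1) Q z * h z =
     \sum_(x <- states B k) \sum_(j in B) p x j * h (cadd x j 1).
    under eq_bigr => z _ do rewrite mulr_suml.
    rewrite exchange_big big_seq [RHS]big_seq; apply: eq_bigr => x xs /=.
    under eq_bigr => z _ do rewrite mulr_suml.
    rewrite exchange_big; apply: eq_bigr => j jB /=.
    rewrite (bigD1_seq (cadd x j 1)) ?states_uniq ?mem_cadd1 //= eqxx mulr1.
    rewrite big1 ?addr0 // => z; rewrite eq_sym => /negbTE ->.
    by rewrite mulr0 mul0r.
  have Qinv h : \sum_(z <- states B k.+1) Q z * cgen B h z = 0.
    rewrite QE -[RHS](pinv (fun x j => h (cadd x j 1))).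
    apply: eq_bigr => x _; apply: eq_bigr => j jB; congr (_ * _).
    exact: cgen_cadd.
  move=> h; rewrite -QE /wsum mulr_suml !big_seq; apply: eq_bigr => z zs.
  rewrite (cgen_invariant iB Qinv zs).
  have := QE (fun=> 1).
  under eq_bigr => z' _ do rewrite mulr1. move=> ->.
  under eq_bigr => x _ do under eq_bigr => j _ do rewrite mulr1.
  by rewrite p1 mul1r; ring.
(* Maximum principle: the density [u] of [p] is tested against [(u - M)_+]. *)
pose N : R := #|B|%:R.
have N0 : 0 < N by rewrite ltr0n; apply/card_gt0P; exists i.
(* Chosen so that [delta * N * M] is [Delta / Zpart r B k], the largest possible inflow at a site:
   the densities at [x] sum to [1 / Zpart r B k] and the increments are at most [Delta]. *)
pose M := Delta / (delta * N) / Zpart r B k.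
pose u x j := p x j / wt x.
have pu x j : p x j = wt x * u x j by rewrite /u mulrCA divff ?mulr1 // gt_eqF // weight_gt0.
have u0 x j : 0 <= u x j by rewrite divr_ge0 // ltW // weight_gt0.
pose F x j := Num.max (u x j - M) 0.
have F0 x j : 0 <= F x j by rewrite le_max lexx orbT.
have S1 : \sum_(x <- states B k) \sum_(j in B) p x j * cgen B (F^~ j) x <= 0.
  rewrite exchange_big /=; apply: sumr_le0 => j jB.
  under eq_bigr => x _ do rewrite pu -mulrA.
  apply: (@cgen_le0 B k (u^~ j) (F^~ j)) => x y; rewrite /F.
  set s := u _ _; set t := u _ _.
  have [st|ts] := leP s t.
    rewrite mulr_le0 ?subr_le0 // /Num.max.
    by case: ltP => ?; case: ltP => ?; lra.
  rewrite mulr_ge0 ?subr_ge0 ?(ltW ts) // /Num.max.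
  by case: ltP => ?; case: ltP => ?; lra.
pose inc x j := r j (x j).+1 - r j (x j).
have incb x j : delta <= inc x j <= Delta by apply: r_incr.
(* Jumps of the second-class particle give inflow minus outflow at [l], weighted by [F]. Where
   [u > M] the outflow is at least [N * delta * u], which exceeds the maximal inflow by
   [N * delta * F]. *)
have S2 x : x \in states B k -> \sum_(j in B) p x j * (inc x j * \sum_(l in B) (F x l - F x j))
    <= - (N * delta * (wt x * \sum_(l in B) F x l ^+ 2)).
  move=> xs.
  have sum_u : \sum_(j in B) u x j = (Zpart r B k)^-1.
    by rewrite -mulr_suml margX // mulrAC divff ?mul1r // gt_eqF // weight_gt0.
  have -> : \sum_(j in B) p x j * (inc x j * \sum_(l in B) (F x l - F x j)) =
     wt x * \sum_(l in B) F x l * (\sum_(j in B) u x j * inc x j - N * (u x l * inc x l)).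
    set C := \sum_(j in B) u x j * inc x j.
    have sF j : \sum_(l in B) (F x l - F x j) = \sum_(l in B) F x l - N * F x j.
      by rewrite sumrB sumr_const mulr_natl.
    have -> : \sum_(l in B) F x l * (C - N * (u x l * inc x l)) =
       C * \sum_(l in B) F x l - \sum_(l in B) u x l * inc x l * (N * F x l).
      by rewrite mulr_sumr -sumrB; apply: eq_bigr => l _; ring.
    rewrite {1}/C mulr_suml -sumrB mulr_sumr; apply: eq_bigr => j _.
    by rewrite sF pu; ring.
  rewrite [X in - X]mulrCA -mulrN; apply: ler_wpM2l; first by rewrite ltW // weight_gt0.
  rewrite mulr_sumr -sumrN; apply: ler_sum => l lB.
  have h1 : \sum_(j in B) u x j * inc x j <= delta * N * M.
    have -> : delta * N * M = (Zpart r B k)^-1 * Delta.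
      by rewrite /M; field; rewrite !gt_eqF.
    rewrite -sum_u mulr_suml; apply: ler_sum => j jB; apply: ler_wpM2l => //.
    by have /andP[] := incb x j.
  have h2 : N * (u x l * delta) <= N * (u x l * inc x l).
    by rewrite ler_pM2l // ler_wpM2l //; have /andP[] := incb x l.
  have [uM|uM] := leP (u x l) M.
    have -> : F x l = 0 by rewrite /F; apply/max_idPr; rewrite subr_le0.
    by rewrite mul0r expr0n /= mulr0 oppr0.
  have -> : F x l = u x l - M by rewrite /F; apply/max_idPl; rewrite subr_ge0 ltW.
  have -> : - (N * delta * (u x l - M) ^+ 2) = (u x l - M) * - (N * delta * (u x l - M)) by ring.
  apply: ler_wpM2l; first by rewrite subr_ge0 ltW.
  lra.
have := pinv F.
under eq_bigr => x _ do (under eq_bigr => j _ do rewrite /sgen mulrDr; rewrite big_split /=).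
rewrite big_split /= => S12.
have S3 : \sum_(x <- states B k) \sum_(j in B) p x j * (inc x j * \sum_(l in B) (F x l - F x j))
   <= - (N * delta * wsum r B k (fun x => \sum_(l in B) F x l ^+ 2)).
  rewrite /wsum mulr_sumr -sumrN big_seq [leRHS]big_seq; exact: ler_sum.
have F2 x : 0 <= \sum_(l in B) F x l ^+ 2 by apply: sumr_ge0 => l _; apply: sqr_ge0.
have /eqP W0 : wsum r B k (fun x => \sum_(l in B) F x l ^+ 2) == 0.
  rewrite eq_le wsum_ge0 ?andbT //.
  have : N * delta * wsum r B k (fun x => \sum_(l in B) F x l ^+ 2) <= 0 by lra.
  by rewrite pmulr_rle0 // mulr_gt0.
move=> x j xs jB.
move: W0 => /eqP; rewrite psumr_eq0 => [|y _]; last by rewrite mulr_ge0 // ltW // weight_gt0.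
move=> /allP/(_ x xs) /=; rewrite mulf_eq0 gt_eqF ?weight_gt0 //= => /eqP h.
have /eqP := psumr_eq0P (fun l _ => sqr_ge0 (F x l)) h jB.
rewrite sqrf_eq0 => /eqP /max_idPr; rewrite subr_le0 => uM.
have -> : Delta / (delta * #|B|%:R) * (wt x / Zpart r B k) = wt x * M by rewrite /M; ring.
by rewrite pu; apply: ler_wpM2l => //; rewrite ltW // weight_gt0.
Qed.

End Coupling.

(** * The complete graph *)

Section CompleteGraph.
Variables (R : realType) (I : finType) (r : I -> nat -> R).
Notation cfg := {ffun I -> nat}.
Hypothesis r0 : forall i, r i 0%N = 0.
Hypothesis r_gt0 : forall i k, (0 < k)%N -> 0 < r i k.
Variables (delta Delta : R).
Hypothesis delta_gt0 : 0 < delta.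
Hypothesis r_incr : forall i k, delta <= r i k.+1 - r i k <= Delta.
Implicit Types (x y z : cfg) (i j : I) (B : {set I}) (k K : nat) (f : cfg -> R).
Local Notation wt := (weight r).

Let Delta_gt0 i : 0 < Delta.
Proof. by have /andP[h1 h2] := r_incr i 0; apply: lt_le_trans delta_gt0 (le_trans h1 h2). Qed.

Let r_le i k : r i k <= Delta * k%:R.
Proof.
elim: k => [|k IH]; first by rewrite r0 mulr0.
by have /andP[_ h] := r_incr i k; rewrite -natr1; lra.
Qed.

Let r_ge i k : delta * k%:R <= r i k.
Proof.
elim: k => [|k IH]; first by rewrite r0 mulr0.
by have /andP[h _] := r_incr i k; rewrite -natr1; lra.
Qed.

Let r_mono i k k' : (k <= k')%N -> r i k <= r i k'.
Proof.
move=> /subnK <-; elim: (k' - k)%N => [|a IH]; first by rewrite add0n.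
by have /andP[h _] := r_incr i (a + k); rewrite addSn; have := delta_gt0; lra.
Qed.

(* The mean rate of each site of [B] in the system with [k] particles. *)
Definition mean_rate B k : R := if k is k'.+1 then Zpart r B k' / Zpart r B k else 0.

(** Integration by parts leaves a ratio of partition functions, the same for every site although the
    rates differ. *)
Lemma mean_rateE B k j : j \in B ->
  wsum r B k (fun x => r j (x j)) = mean_rate B k * Zpart r B k.
Proof.
move=> jB; transitivity (wsum r B k (fun x => r j (x j) * 1)).
  by apply: eq_wsum => x _; rewrite mulr1.
case: k => [|k]; first by rewrite (wsum_ibp0 r0) mul0r.
rewrite (wsum_ibp r0 r_gt0 k (fun=> 1) jB) /= -/(Zpart r B k) divfK // gt_eqF //.
exact: (Zpart_gt0 r_gt0 _ jB).
Qed.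

(** Sum [delta * x <= r x <= Delta * x] over the sites, where the occupations add up to [k]. *)
Lemma mean_rate_bounds B k j : j \in B ->
  delta * k%:R <= #|B|%:R * mean_rate B k <= Delta * k%:R.
Proof.
move=> jB; have Z0 : 0 < Zpart r B k by apply: Zpart_gt0 jB.
have e : #|B|%:R * mean_rate B k * Zpart r B k = wsum r B k (fun x => \sum_(j in B) r j (x j)).
  rewrite wsum_sum (eq_bigr _ (fun i iB => mean_rateE k iB)).
  by rewrite sumr_const mulr_natl mulrnAl.
have sB x : x \in states B k -> \sum_(j in B) (x j)%:R = k%:R :> R.
  rewrite mem_states => /andP[/eqP <- /forallP h].
  rewrite natr_sum [RHS](bigID (mem B)) /= [X in _ = _ + X]big1 ?addr0 // => i iB.
  by have := h i; rewrite (negbTE iB) /= => /eqP ->.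
rewrite -(ler_pM2r Z0) -[in X in _ && X](ler_pM2r Z0) e.
have c (a : R) : a * Zpart r B k = wsum r B k (fun=> a).
  by rewrite /Zpart -wsumZ; apply: eq_wsum => x _; rewrite mulr1.
rewrite !c; apply/andP; split; apply: (le_wsum r_gt0) => x xs.
  by rewrite -(sB x xs) mulr_sumr; apply: ler_sum.
by rewrite -(sB x xs) mulr_sumr; apply: ler_sum.
Qed.

(** In the coupling the second configuration dominates the first, and the rates are
    nondecreasing. *)
Lemma mean_rate_mono B k j : j \in B -> mean_rate B k <= mean_rate B k.+1.
Proof.
move=> jB.
have Z0 k' : 0 < Zpart r B k' by apply: (Zpart_gt0 r_gt0 k' jB).
have [p [p0 h1 h2 _]] := coupling r0 r_gt0 delta_gt0 r_incr k jB.
have e k' : mean_rate B k' = wsum r B k' (fun x => r j (x j)) / Zpart r B k'.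
  by rewrite (mean_rateE k' jB) mulfK // gt_eqF.
rewrite !e -h1 -h2; apply: ler_sum => x _; apply: ler_sum => l lB.
apply: ler_wpM2l; first exact: p0.
by apply: r_mono; rewrite ffunE leq_addr.
Qed.

Lemma mean_rate_gt0 B k j : j \in B -> 0 < mean_rate B k.+1.
Proof. by move=> jB; rewrite divr_gt0 // (Zpart_gt0 r_gt0 _ jB). Qed.

(** Joint convexity gives the bound under the coupling [p]; the density estimate then replaces [p]
    by the weights times the counting measure on [B]. *)
Lemma coupling_sqdist B k i (f1 f2 : cfg -> R) : i \in B ->
  (forall x, 0 <= f1 x) -> (forall x, 0 <= f2 x) ->
  sqdist (wsum r B k f1 / Zpart r B k) (wsum r B k.+1 f2 / Zpart r B k.+1) <=
  Delta / (delta * #|B|%:R) *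
    (wsum r B k (fun x => \sum_(j in B) sqdist (f1 x) (f2 (cadd x j 1))) / Zpart r B k).
Proof.
move=> iB f10 f20.
have [p [p0 h1 h2 pb]] := coupling r0 r_gt0 delta_gt0 r_incr k iB.
rewrite -h1 -h2.
pose s := [seq (x, j) | x <- states B k, j <- enum B].
have sE (F : cfg * I -> R) : \sum_(a <- s) F a = \sum_(x <- states B k) \sum_(j in B) F (x, j).
  by rewrite big_allpairs; apply: eq_bigr => x _; rewrite big_enum.
rewrite -(sE (fun a => p a.1 a.2 * f1 a.1)) -(sE (fun a => p a.1 a.2 * f2 (cadd a.1 a.2 1))).
apply: le_trans (sqdist_sum _ _ _ _) _ => //.
rewrite sE /= /wsum mulr_suml mulr_sumr big_seq [leRHS]big_seq.
apply: ler_sum => x xs; rewrite mulr_sumr mulr_suml mulr_sumr; apply: ler_sum => j jB.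
have := ler_wpM2r (sqdist_ge0 (f1 x) (f2 (cadd x j 1))) (pb x j xs jB).
by move=> h; apply: le_trans h _; rewrite le_eqVlt; apply/orP; left; apply/eqP; ring.
Qed.

Definition site_marginal B K i (l : nat) : R :=
  site_weight r i l * Zpart r (B :\ i) (K - l)%N.

Definition site_mean B K f i (l : nat) : R :=
  wsum r (B :\ i) (K - l)%N (fun z => f (cadd z i l)) / Zpart r (B :\ i) (K - l)%N.

(** Chain rule of entropy for the occupation of [i]. The site [j] witnesses that others exist, so
    that their partition functions are positive. *)
Lemma entropy_chain B K i j f : i \in B -> j \in B :\ i ->
  entropy (states B K) wt f =
  \sum_(l < K.+1) site_weight r i l *
     entropy (states (B :\ i) (K - l)%N) wt (fun z => f (cadd z i l))
  + entropy (index_iota 0 K.+1) (site_marginal B K i) (site_mean B K f i).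
Proof.
move=> iB jB; set nu := site_marginal B K i; set F := site_mean B K f i.
have Z0 k : 0 < Zpart r (B :\ i) k by apply: (Zpart_gt0 r_gt0 _ jB).
have nuF (l : nat) : nu l * F l = site_weight r i l * wsum r (B :\ i) (K - l)%N (fun z => f (cadd z i l)).
  by rewrite /nu /F /site_marginal /site_mean; field; rewrite gt_eqF.
rewrite /entropy !big_mkord.
have -> : \sum_(x <- states B K) wt x = \sum_(l < K.+1) nu l.
  have := wsum_cond r K (fun=> 1) iB; rewrite /wsum.
  under eq_bigr do rewrite mulr1.
  by move=> ->.
rewrite (eq_bigr _ (fun (l : 'I_K.+1) _ => nuF l)).
rewrite -[\sum_(x <- states B K) wt x * f x]/(wsum r B K f) (wsum_cond r K f iB).
rewrite addrA; congr (_ - _).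
rewrite -[LHS]/(wsum r B K (fun x => f x * ln (f x))) (wsum_cond r K _ iB) -big_split.
apply: eq_bigr => l _ /=; rewrite mulrA nuF -mulrA -mulrDr; congr (_ * _).
rewrite -[\sum_(x <- _) wt x * f (cadd x i l)]/(wsum r (B :\ i) (K - l)%N (fun z => f (cadd z i l))).
rewrite -/(F l).
have -> : \sum_(x <- states (B :\ i) (K - l)%N) wt x = Zpart r (B :\ i) (K - l)%N.
  by rewrite /Zpart /wsum; apply: eq_bigr => z _; rewrite mulr1.
by rewrite -/(F l) subrK.
Qed.

Variable T : R.
Hypothesis T4 : 4 <= T.

Definition exchange_form B K f i j : R :=
  wsum r B K (fun y => sqdist (f (cadd y i 1)) (f (cadd y j 1))).

(** The occupation of [i] is reversible for the chain with death rate [r i] and, as birth rate, the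
    mean rate of the other sites. Its edges compare conditional means that differ by one particle
    outside [i], as in [coupling_sqdist]. *)
Lemma marginal_log_sobolev B K i j f : i \in B -> j \in B :\ i ->
  2 * Delta * K.+1%:R * #|B|%:R <= delta * T -> (forall x, 0 < f x) ->
  entropy (index_iota 0 K.+2) (site_marginal B K.+1 i) (site_mean B K.+1 f i) <=
   10 * ln T / delta * (Delta / (delta * #|B :\ i|%:R) *
     \sum_(l in B :\ i) exchange_form B K f i l).
Proof.
move=> iB jB hT f0; set nu := site_marginal B K.+1 i; set F := site_mean B K.+1 f i.
have D0 : 0 < Delta := Delta_gt0 i.
have d0 := delta_gt0.
have Z0 k : 0 < Zpart r (B :\ i) k by apply: (Zpart_gt0 r_gt0 _ jB).
have N'0 : 0 < #|B :\ i|%:R :> R by rewrite ltr0n; apply/card_gt0P; exists j.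
have N'1 : 1 <= #|B :\ i|%:R :> R by rewrite ler1n; apply/card_gt0P; exists j.
have NN' : #|B :\ i|%:R <= #|B|%:R :> R by rewrite ler_nat subset_leq_card // subD1set.
pose b l := mean_rate (B :\ i) (K.+1 - l)%N.
(* Birth and death rates at a state add up to at most [Delta * K.+1], so the chain stays put with
   probability at least 1/2. *)
pose eps := (2 * Delta * K.+1%:R)^-1.
have K0 : 0 < K.+1%:R :> R by rewrite ltr0n.
have eps0 : 0 < eps by rewrite invr_gt0 !mulr_gt0.
have b_le l : b l <= Delta * (K.+1 - l)%:R.
  have /andP[_ h] := mean_rate_bounds (K.+1 - l)%N jB.
  apply: le_trans h; rewrite ler_peMl // /b; case: (K.+1 - l)%N => [|?] //=.
  by rewrite divr_ge0 // ltW.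
have epsE (a : R) : eps * a = a / (2 * Delta * K.+1%:R) by rewrite mulrC.
(* This decides the size of [T]: a birth rate may be as low as [delta / #|B :\ i|], hence a
   transition probability as low as [eps] times that. *)
have nT : #|B|%:R <= T * eps * delta.
  have -> : T * eps * delta = delta * T / (2 * Delta * K.+1%:R) by rewrite /eps; ring.
  by rewrite ler_pdivlMr ?mulr_gt0 // [leLHS]mulrC.
have n1 : 1 <= #|B|%:R :> R by apply: le_trans NN'.
have T0 : 0 < T by have := T4; lra.
have bd : entropy (index_iota 0 K.+2) nu F <= 10 * ln T / delta * bd_form K.+1 nu b F.
  apply: (@bd_log_sobolev R K.+1 nu (r i) b delta eps T) => //.
  - by move=> k _; rewrite mulr_gt0 // (site_weight_gt0 r_gt0).
  - move=> k kK; rewrite /nu /site_marginal /b.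
    rewrite mulrAC (site_weightS r_gt0) subnS; case E : (K.+1 - k)%N => [|a] /=.
      by move/eqP: E; rewrite subn_eq0 leqNgt kK.
    by rewrite -!mulrA [Zpart r _ a.+1 * _]mulrCA divff ?mulr1 // gt_eqF.
  - by rewrite /b subnn.
  - by move=> k _; apply: le_trans (r_ge i k); rewrite mulr_ge0 // ltW.
  - move=> k kK; rewrite /b; case E : (K.+1 - k)%N => [|a].
      by move/eqP: E; rewrite subn_eq0 leqNgt kK.
    exact: mean_rate_gt0 jB.
  - by move=> k _; have /andP[h _] := r_incr i k; lra.
  - move=> k kK; rewrite /b subnS; case E : (K.+1 - k)%N => [|a] //.
    by rewrite /= (mean_rate_mono a jB).
  - move=> k kK; rewrite epsE ler_pdivrMr ?mulr_gt0 // mul1r.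
    apply: le_trans (lerD (b_le k) (r_le i k.+1)) _.
    rewrite -mulrDr -natrD addnS subnK ?(ltnW kK) // -mulrA mulrCA ler_pM2l //.
    rewrite -natr1; have : 1 <= K.+1%:R :> R by rewrite ler1n.
    lra.
  - move=> k kK.
    have h : b k + r i k <= Delta * K.+1%:R.
      apply: le_trans (lerD (b_le k) (r_le i k)) _.
      by rewrite -mulrDr -natrD subnK.
    have h2 : eps * (b k + r i k) <= 1 / 2.
      rewrite epsE ler_pdivrMr ?mulr_gt0 //; lra.
    have := T4 => T4'; apply: (@le_trans _ _ (T * (1 / 2))); first lra.
    by rewrite ler_pM2l //; lra.
  - move=> k kK; apply: le_trans n1 _; apply: le_trans nT _; rewrite -mulrA ler_pM2l // ler_pM2l //.
    by have /andP[h _] := r_incr i k; apply: le_trans h _; rewrite gerBl (le_trans _ (r_ge i k)) // mulr_ge0 // ltW.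
  - move=> k kK; have /andP[h _] := mean_rate_bounds (K.+1 - k)%N jB.
    have k1 : 1 <= (K.+1 - k)%:R :> R by rewrite ler1n subn_gt0.
    have h3 : delta <= #|B :\ i|%:R * b k by apply: le_trans h; rewrite ler_peMr // ltW.
    rewrite -(ler_pM2l N'0) mulr1; apply: le_trans NN' _; apply: le_trans nT _.
    have -> : #|B :\ i|%:R * (T * (eps * b k)) = T * eps * (#|B :\ i|%:R * b k) by ring.
    by rewrite ler_pM2l ?mulr_gt0.
  - by move=> k _; rewrite divr_gt0 //; apply: (wsum_gt0 r_gt0 _ jB).
apply: le_trans bd _; apply: ler_wpM2l.
  by rewrite divr_ge0 ?mulr_ge0 ?ln_ge0 ?(ltW d0) //; have := T4; lra.
(* Condition on [l] particles at [i]: the exchanged particle either brings [i] to [l.+1] or sits at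
   another site. *)
have wE : \sum_(l in B :\ i) exchange_form B K f i l =
   \sum_(l < K.+1) site_weight r i l * wsum r (B :\ i) (K - l)%N
     (fun z => \sum_(j in B :\ i) sqdist (f (cadd z i l.+1)) (f (cadd (cadd z j 1) i l))).
  rewrite /exchange_form -wsum_sum (wsum_cond r K _ iB); apply: eq_bigr => l _.
  congr (_ * _); apply: eq_wsum => z _; apply: eq_bigr => a _.
  by rewrite caddD addn1 (caddC z a).
rewrite wE mulr_sumr; apply: ler_sum => l _.
have lK : (l <= K)%N by rewrite -ltnS.
(* The flux through an edge contains the partition function with [K - l] particles, which cancels
   the normalization in [coupling_sqdist]. *)
have -> : nu l * b l = site_weight r i l * Zpart r (B :\ i) (K - l)%N.
  rewrite /nu /site_marginal /b subSn //= -!mulrA [Zpart r _ _.+1 * _]mulrCA divff ?mulr1 //.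
  by rewrite gt_eqF.
have h := @coupling_sqdist (B :\ i) (K - l)%N j (fun z => f (cadd z i l.+1))
  (fun z => f (cadd z i l)) jB (fun x => ltW (f0 _)) (fun x => ltW (f0 _)).
rewrite /F /site_mean subSS subSn //.
have wZ : 0 <= site_weight r i l * Zpart r (B :\ i) (K - l)%N.
  by rewrite mulr_ge0 // ltW // (site_weight_gt0 r_gt0).
apply: le_trans (ler_wpM2l wZ h) _; rewrite le_eqVlt; apply/orP; left; apply/eqP.
by field; rewrite !gt_eqF.
Qed.

Lemma exchange_form_ge0 B K f i j : 0 <= exchange_form B K f i j.
Proof. by apply: (wsum_ge0 r_gt0) => y _; apply: sqdist_ge0. Qed.

(** The constant survives the induction exactly. For [N + 2] sites, conditioning on [a] gives
    [(N + 1) Ent <= C (Q - Q_a)] with [Q_a] the sum over pairs ending at [a]. The [Q_a] add up to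
    [Q], so summing over [a] gives [(N + 2) (N + 1) Ent <= C (N + 1) Q]. *)
Lemma complete_log_sobolev B K f i : i \in B ->
  2 * Delta * K.+1%:R * #|B|%:R <= delta * T -> (forall x, 0 < f x) ->
  entropy (states B K.+1) wt f <=
    10 * ln T * Delta / delta ^+ 2 / #|B|%:R *
    \sum_(a in B) \sum_(b in B) exchange_form B K f a b.
Proof.
move: {2}#|B| (erefl #|B|) => N; elim: N B K f i => [|N IH] B K f i Bn iB hT f0.
  by move/card0_eq/(_ i): Bn; rewrite iB.
have D0 : 0 < Delta := Delta_gt0 i.
have d0 := delta_gt0.
have lT : 0 <= ln T by rewrite ln_ge0 //; have := T4; lra.
set C := 10 * ln T * Delta / delta ^+ 2.
have C0 : 0 <= C by rewrite !mulr_ge0 ?invr_ge0 ?exprn_ge0 ?(ltW D0) ?(ltW d0) ?ler0n.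
set Q := \sum_(a in B) \sum_(b in B) _.
have Q0 : 0 <= Q.
  by apply: sumr_ge0 => a _; apply: sumr_ge0 => b _; apply: exchange_form_ge0.
case: N IH Bn => [|N] IH Bn.
  rewrite entropy_const => [|x _|x y]; last 2 first.
  - exact: weight_gt0.
  - have /eqP/cards1P[a ->] := Bn.
    by move=> xs ys; rewrite (states1_eq xs ys).
  by apply: mulr_ge0 Q0; apply: mulr_ge0 C0 _; rewrite invr_ge0.
have site a : a \in B -> N.+1%:R * entropy (states B K.+1) wt f <=
    C * (Q - \sum_(b in B) exchange_form B K f b a).
  move=> aB.
  have cardB : #|B :\ a| = N.+1 by move: Bn; rewrite (cardsD1 a) aB => -[].
  have [b bB] : exists b, b \in B :\ a by apply/card_gt0P; rewrite cardB.
  have N0 : 0 < N.+1%:R :> R by rewrite ltr0n.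
  have h1 := marginal_log_sobolev aB bB hT f0.
  rewrite (entropy_chain K.+1 f aB bB).
  have h2 : \sum_(l < K.+2) site_weight r a l *
     entropy (states (B :\ a) (K.+1 - l)%N) wt (fun z => f (cadd z a l)) <=
     C / N.+1%:R * \sum_(c in B :\ a) \sum_(d in B :\ a) exchange_form B K f c d.
    (* With all particles at [a], the other sites have a single configuration and no entropy. *)
    rewrite big_ord_recr /= subnn [X in _ * X]entropy_const ?mulr0 ?addr0; last 2 first.
    - by move=> x _; apply: weight_gt0.
    - by move=> x y xs ys; rewrite (states0_eq xs ys).
    have -> : \sum_(c in B :\ a) \sum_(d in B :\ a) exchange_form B K f c d =
       \sum_(l < K.+1) site_weight r a l * \sum_(c in B :\ a) \sum_(d in B :\ a)
         exchange_form (B :\ a) (K - l)%N (fun z => f (cadd z a l)) c d.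
      under [RHS]eq_bigr => l _ do (rewrite mulr_sumr; under eq_bigr => c _ do rewrite mulr_sumr).
      rewrite [RHS]exchange_big /=; apply: eq_bigr => c _.
      rewrite [RHS]exchange_big /=; apply: eq_bigr => d _.
      rewrite /exchange_form (wsum_cond r K _ aB); apply: eq_bigr => l _.
      by congr (_ * _); apply: eq_wsum => z _; rewrite !(caddC z a).
    rewrite mulr_sumr; apply: ler_sum => l _; rewrite mulrCA.
    apply: ler_wpM2l; first by rewrite ltW // (site_weight_gt0 r_gt0).
    have lK : (l <= K)%N by rewrite -ltnS.
    rewrite subSn // -cardB; apply: (IH _ _ _ b) => //.
    (* Fewer particles and fewer sites: one [T] serves all subsystems. *)
    apply: le_trans hT; rewrite ler_pM ?mulr_ge0 ?ler0n ?(ltW D0) //.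
      by rewrite ler_pM2l ?mulr_gt0 // ler_nat ltnS leq_subr.
    by rewrite ler_nat subset_leq_card // subD1set.
  rewrite cardB in h1.
  have e (F : I -> R) : \sum_(c in B :\ a) F c = \sum_(c in B) F c - F a.
    by rewrite [in RHS](big_setD1 a) //= addrAC subrr add0r.
  have exx : exchange_form B K f a a = 0.
    by rewrite /exchange_form /wsum big1 // => z _; rewrite sqdistxx mulr0.
  (* The inductive part covers the pairs avoiding [a], the marginal part those starting at [a]:
     together, all pairs not ending at [a]. *)
  have S2 : \sum_(c in B :\ a) \sum_(d in B :\ a) exchange_form B K f c d
     + \sum_(d in B :\ a) exchange_form B K f a d = Q - \sum_(c in B) exchange_form B K f c a.
    rewrite (e (fun c => \sum_(d in B :\ a) exchange_form B K f c d)) subrK.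
    under eq_bigr => c _ do rewrite e.
    by rewrite sumrB.
  rewrite -S2 [leLHS]mulrDr [leRHS]mulrDr; apply: lerD.
    apply: le_trans (ler_wpM2l (ltW N0) h2) _.
    by rewrite le_eqVlt; apply/orP; left; apply/eqP; field; rewrite !gt_eqF.
  apply: le_trans (ler_wpM2l (ltW N0) h1) _.
  by rewrite le_eqVlt; apply/orP; left; apply/eqP; rewrite /C; field; rewrite !gt_eqF.
have : \sum_(a in B) N.+1%:R * entropy (states B K.+1) wt f <=
       \sum_(a in B) C * (Q - \sum_(b in B) exchange_form B K f b a).
  exact: ler_sum.
rewrite sumr_const -mulr_sumr sumrB sumr_const [X in _ - X]exchange_big /= -/Q Bn.
rewrite -[Q *+ _]mulr_natl -[_ *+ N.+2]mulr_natl.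
have -> : C * (N.+2%:R * Q - Q) = N.+1%:R * (C * Q) by rewrite -[N.+2%:R]natr1; ring.
rewrite mulrCA ler_pM2l ?ltr0n // => h.
rewrite mulrAC ler_pdivlMr ?ltr0n // mulrC //.
Qed.
End CompleteGraph.

(** * The spectral gap *)

Section RealSpectral.
Import complex.
Local Open Scope sesquilinear_scope.
Variables (R : realType) (n : nat) (G : 'M[R]_n).
Hypothesis Gsym : G^T = G.

Lemma sum_complex (I : Type) (s : seq I) (P : pred I) (a b : I -> R) :
  (\sum_(i <- s | P i) (a i +i* b i)%C) = ((\sum_(i <- s | P i) a i) +i* (\sum_(i <- s | P i) b i))%C :> R[i].
Proof.
by elim/big_rec3: _ => [|i x y z _ ->].
Qed.

Lemma conj_complex (z : R[i]) : z^*%R = (complex.Re z -i* complex.Im z)%C.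
Proof. by case: z. Qed.

Lemma real_complex_real (x : R) : x%:C%C \is Num.real.
Proof.
rewrite realE -[0]/((0 : R)%:C%C) !lecR; exact: num_real.
Qed.

(* [U + i V] is a unitary matrix diagonalizing [G] over the complex numbers. *)
Lemma symmetric_spectral : exists (d : 'I_n -> R) (U V : 'M[R]_n),
  [/\ char_poly G = \prod_i ('X - (d i)%:P),
      forall i k, \sum_j U i j * G j k = d i * U i k /\ \sum_j V i j * G j k = d i * V i k,
      forall i k, \sum_j (U i j * U k j + V i j * V k j) = (i == k)%:R /\
                  \sum_j (V i j * U k j - U i j * V k j) = 0 &
      forall j k, \sum_i (U i j * U i k + V i j * V i k) = (j == k)%:R].
Proof.
pose toC := real_complex R.
pose A : 'M[R[i]]_n := map_mx toC G.
have Aherm : A \is hermsymmx.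
  apply/is_hermitianmxP; rewrite expr0 scale1r; apply/matrixP => i j.
  by rewrite !mxE -[in G j i]Gsym mxE; apply/esym/CrealP/real_complex_real.
have /orthomx_spectralP A_eq := hermitian_normalmx Aherm.
have d_real := hermitian_spectral_diag_real Aherm.
have Pu := spectral_unitarymx A.
set P := spectralmx A in A_eq Pu; set D := spectral_diag A in A_eq d_real.
have Punit := unitarymx_unit Pu.
exists (fun i => complex.Re (D 0 i)), (map_mx (@complex.Re R) P), (map_mx (@complex.Im R) P).
have DE i : D 0 i = (complex.Re (D 0 i))%:C%C.
  have /mxOverP/(_ 0 i)/CrealP := d_real.
  rewrite conj_complex; case: (D 0 i) => a b /= [] /eqP.
  by rewrite eq_sym -addr_eq0 -mulr2n mulrn_eq0 /= => /eqP ->.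
have PP : P *m P ^t* = 1%:M by apply/unitarymxP.
have PP' : P ^t* *m P = 1%:M by apply: mulmx1C.
have PG : P *m A = diag_mx D *m P.
  by rewrite [in LHS]A_eq -!mulmxA mulKVmx.
have zE (z : R[i]) : z = (complex.Re z +i* complex.Im z)%C by case: z.
split.
- have toC_inj : injective (map_poly toC) by apply: map_poly_inj.
  apply: toC_inj; rewrite map_char_poly -/A rmorph_prod /=.
  transitivity (char_poly (diag_mx D)).
    rewrite A_eq /char_poly.
    have -> : char_poly_mx (invmx P *m diag_mx D *m P) =
       map_mx polyC (invmx P) *m char_poly_mx (diag_mx D) *m map_mx polyC P.
      rewrite /char_poly_mx mulmxBr mulmxBl !map_mxM /=; congr (_ - _).
      by rewrite scalar_mxC -mulmxA -map_mxM mulVmx // map_mx1 mulmx1.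
    by rewrite !det_mulmx mulrAC -det_mulmx -map_mxM mulVmx // map_mx1 det1 mul1r.
  rewrite char_poly_trig ?diag_mx_is_trig //; apply: eq_bigr => i _.
  by rewrite mxE eqxx mulr1n rmorphB /= map_polyX map_polyC /= [in LHS]DE.
- move=> i k; have /matrixP/(_ i k) := PG.
  rewrite mul_diag_mx !mxE DE.
  under eq_bigr => j _ do rewrite mxE (zE (P i j)) -[_ * _]/((_ * _ - _ * 0) +i* (_ * 0 + _ * _))%C.
  rewrite sum_complex [P i k in RHS]zE => -[h1 h2].
  split.
    move: h1; rewrite mul0r subr0 => <-.
    by apply: eq_bigr => j _; rewrite !mxE mulr0 subr0.
  move: h2; rewrite mul0r addr0 => <-.
  by apply: eq_bigr => j _; rewrite !mxE mulr0 add0r.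
- move=> i k; have /matrixP/(_ i k) := PP; rewrite !mxE.
  under eq_bigr => j _ do rewrite !mxE conj_complex (zE (P i j)) -[_ * _]/((_ * _ - _ * - _) +i* (_ * - _ + _ * _))%C.
  rewrite sum_complex (_ : (i == k)%:R = ((i == k)%:R)%:C%C) => [|]; last by case: eqP.
  move=> [h1 h2]; split.
    by rewrite -h1; apply: eq_bigr => j _; rewrite !mxE mulrN opprK.
  by rewrite -[RHS]h2; apply: eq_bigr => j _; rewrite !mxE mulrN addrC.
move=> j k; have /matrixP/(_ j k) := PP'; rewrite !mxE.
under eq_bigr => i _ do rewrite !mxE conj_complex (zE (P i k)) -[_ * _]/((_ * _ - - _ * _) +i* (_ * _ + - _ * _))%C.
rewrite sum_complex (_ : (j == k)%:R = ((j == k)%:R)%:C%C) => [|]; last by case: eqP.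
move=> [h1 h2].
by rewrite -h1; apply: eq_bigr => i _; rewrite !mxE mulNr opprK.
Qed.

End RealSpectral.

(** * Poincare inequality for a symmetric stochastic matrix *)

Section SpectralGap.
Variables (R : realType) (n : nat) (G : 'M[R]_n).
Hypothesis Gsym : G^T = G.
Hypothesis Gstoch : stochastic G.
Hypothesis Girr : irreducible G.
Implicit Types f g h : 'I_n -> R.

(** Both lists contain each [x] as often as its multiplicity as a root of the characteristic
    polynomial. *)
Lemma perm_eigenvalues (d : 'I_n -> R) : char_poly G = \prod_i ('X - (d i)%:P) ->
  perm_eq (eigenvalues G) [seq d i | i <- enum 'I_n].
Proof.
move=> Gd; rewrite /eigenvalues perm_sort; apply/allP => x _ /=; apply/eqP.
have -> : count_mem x [seq d i | i <- enum 'I_n] = mup x (char_poly G).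
  by rewrite Gd -mu_prod_XsubC big_map big_enum.
have p0 : char_poly G != 0 by rewrite monic_neq0 // char_poly_monic.
have rs x' : (x' \in polyrcf.rootsR (char_poly G)) = root (char_poly G) x'.
  by have := polyrcf.roots_on_rootsR p0 x'; rewrite in_itv /= => <-.
rewrite count_flatten sumnE !big_map.
under eq_bigr => a _ do rewrite count_nseq /=.
have [rx|rx] := boolP (root (char_poly G) x); last first.
  rewrite (mupNroot rx) big_seq big1 // => a; rewrite rs => ra.
  by case: eqP => // e; rewrite e (negbTE rx) in ra.
rewrite (bigD1_seq x) ?rs ?polyrcf.uniq_roots //= eqxx mul1n big1 ?addn0 // => a.
by move=> /negbTE ->.
Qed.

Let G_ge0 i j : 0 <= G i j. Proof. by have [] := Gstoch. Qed.
Let G_row i : \sum_j G i j = 1. Proof. by have [] := Gstoch. Qed.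
Let GC i j : G i j = G j i. Proof. by rewrite -{1}Gsym mxE. Qed.

Lemma stochastic_energy f : \sum_i \sum_j G i j * (f i - f j) ^+ 2 =
  2 * (\sum_i f i ^+ 2 - \sum_k f k * \sum_j f j * G j k).
Proof.
have e1 : \sum_i \sum_j G i j * f i ^+ 2 = \sum_i f i ^+ 2.
  by apply: eq_bigr => i _; rewrite -mulr_suml G_row mul1r.
have e2 : \sum_i \sum_j G i j * f j ^+ 2 = \sum_i f i ^+ 2.
  rewrite exchange_big -e1; apply: eq_bigr => i _; apply: eq_bigr => j _.
  by rewrite GC.
have e3 : \sum_i \sum_j G i j * (f i * f j) = \sum_k f k * \sum_j f j * G j k.
  apply: eq_bigr => i _; rewrite mulr_sumr; apply: eq_bigr => j _.
  by rewrite (GC j i); ring.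
rewrite mulrBr -{1}e1 mulr2n mulrDl mul1r e1 -{1}e1 -{1}e2 -e3 mulrDl mul1r.
rewrite -!big_split -sumrB; apply: eq_bigr => i _ /=.
by rewrite -!big_split -sumrB; apply: eq_bigr => j _ /=; ring.
Qed.

(** A harmonic [f] has zero energy, so it agrees across every positive entry of [G]; a positive
    entry of a power of [G] contains a path of such steps. *)
Lemma irreducible_harmonic f : (forall k, \sum_j f j * G j k = f k) ->
  forall i j, f i = f j.
Proof.
move=> fh.
have E0 : \sum_i \sum_j G i j * (f i - f j) ^+ 2 = 0.
  rewrite stochastic_energy; under [X in _ - X]eq_bigr => k _ do rewrite fh -expr2.
  by rewrite subrr mulr0.
have ge0 i j : 0 <= G i j * (f i - f j) ^+ 2 by rewrite mulr_ge0 ?sqr_ge0.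
have step i j : 0 < G i j -> f i = f j.
  move=> Gij; have E1 := psumr_eq0P (fun i _ => sumr_ge0 _ (fun j _ => ge0 i j)) E0.
  have /eqP := psumr_eq0P (fun j _ => ge0 i j) (E1 i isT) (i := j) isT.
  by rewrite mulf_eq0 gt_eqF //= sqrf_eq0 subr_eq0 => /eqP.
have Gk_ge0 k i j : 0 <= (G ^+ k) i j.
  elim: k i j => [|k IH] i j; first by rewrite expr0 mxE ler0n.
  by rewrite exprS -[_ * _]/(G *m _) mxE sumr_ge0 // => l _; rewrite mulr_ge0.
move=> i j; have [k] := Girr i j.
elim: k i => [|k IH] i.
  by rewrite expr0 mxE; case: eqP => [->|]; rewrite ?ltxx.
rewrite exprS -[_ * _]/(G *m _) mxE => pos.
have [l /andP[Gil Glj]] : exists l, (0 < G i l) && (0 < (G ^+ k) l j).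
  apply/existsP; apply: contraLR pos => /existsPn no.
  rewrite -leNgt sumr_le0 // => l _; have := no l; rewrite negb_and -!leNgt.
  case/orP => h.
    by rewrite (_ : G i l = 0) ?mul0r //; apply/eqP; rewrite eq_le h G_ge0.
  by rewrite (_ : (G ^+ k) l j = 0) ?mulr0 //; apply/eqP; rewrite eq_le h Gk_ge0.
by rewrite (step _ _ Gil) (IH _ Glj).
Qed.

Lemma second_eigenvalue (d : 'I_n -> R) i0 : (2 <= n)%N ->
  char_poly G = \prod_i ('X - (d i)%:P) -> d i0 = 1 ->
  (forall i, i != i0 -> d i < 1) ->
  nth 0 (eigenvalues G) 1 < 1 /\ forall i, i != i0 -> d i <= nth 0 (eigenvalues G) 1.
Proof.
move=> hn Gd d0 d1.
pose t := [seq d i | i <- rem i0 (enum 'I_n)].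
have mem_rem i : (i \in rem i0 (enum 'I_n)) = (i != i0).
  by rewrite mem_rem_uniq ?enum_uniq // !inE mem_enum andbT.
have tr : transitive (>=%R : rel R) by move=> a b c ab ca; apply: le_trans ca ab.
have as_ : antisymmetric (>=%R : rel R) by move=> a b /le_anti.
have tt : total (>=%R : rel R) by move=> a b; apply: le_total.
have st : sorted >=%R (sort >=%R t) by apply: sort_sorted.
have t_lt1 x : x \in t -> x < 1 by move=> /mapP[i]; rewrite mem_rem => /d1 + ->.
have e : eigenvalues G = 1 :: sort >=%R t.
  apply: (sorted_eq tr as_); first exact: sort_sorted.
    rewrite /= path_sortedE // st andbT; apply/allP => x; rewrite mem_sort => /t_lt1.
    exact: ltW.
  apply: (perm_trans (perm_eigenvalues Gd)).
  rewrite perm_sym (perm_trans (_ : perm_eq _ (1 :: t))) ?perm_cons ?perm_sort //.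
  by rewrite -d0 -map_cons perm_sym perm_map // perm_to_rem ?mem_enum.
have size_t : (0 < size (sort >=%R t))%N.
  by rewrite size_sort size_map size_rem ?mem_enum // -cardE card_ord; case: n hn => [|[]].
rewrite e /=; case E : (sort >=%R t) size_t st => [|x s] //= _ st.
have xt : x \in t by rewrite -(mem_sort >=%R) E mem_head.
split; first exact: t_lt1.
move=> i ii0; have : d i \in sort >=%R t by rewrite mem_sort map_f // mem_rem.
rewrite E inE => /orP[/eqP -> //|]; move: st; rewrite path_sortedE // => /andP[/allP h _].
by move=> /h.
Qed.

(** The eigenvalue 1 is simple with a constant eigenvector, so a centred function has no component
    on it, and every other component has [1 - d i] at least the gap. *)
Lemma spectral_gap_poincare : (2 <= n)%N -> 0 < spectral_gap G /\ forall h,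
  spectral_gap G * (\sum_i \sum_j (h i - h j) ^+ 2) <=
    n%:R * (\sum_i \sum_j G i j * (h i - h j) ^+ 2).
Proof.
move=> hn; have [d [U [V [Gd UVG rows cols]]]] := symmetric_spectral Gsym.
have n0 : 0 < n%:R :> R by rewrite ltr0n ltnW.
pose u h i := \sum_j U i j * h j; pose v h i := \sum_j V i j * h j.
have parseval h g : \sum_i (u h i * u g i + v h i * v g i) = \sum_j h j * g j.
  have e (W : 'M[R]_n) i : (\sum_j W i j * h j) * (\sum_j W i j * g j) =
    \sum_j \sum_k h j * g k * (W i j * W i k).
    rewrite mulr_suml; apply: eq_bigr => j _; rewrite mulr_sumr; apply: eq_bigr => k _.
    by ring.
  under eq_bigr => i _ do (rewrite /u /v !e -big_split /=; under eq_bigr => j _ do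
     (rewrite -big_split /=; under eq_bigr => k _ do rewrite -mulrDr)).
  rewrite exchange_big; apply: eq_bigr => j _ /=.
  rewrite exchange_big (bigD1 j) //= -mulr_sumr cols eqxx mulr1 big1 ?addr0 // => k kj.
  by rewrite -mulr_sumr cols eq_sym (negbTE kj) mulr0.
pose gh h k := \sum_j h j * G j k.
have ugh h i : u (gh h) i = d i * u h i.
  rewrite /u /gh mulr_sumr.
  under eq_bigr => j _ do rewrite mulr_sumr.
  rewrite exchange_big; apply: eq_bigr => k _ /=.
  by rewrite mulrA; have [<- _] := UVG i k; rewrite mulr_suml; apply: eq_bigr => j _; rewrite (GC k); ring.
have vgh h i : v (gh h) i = d i * v h i.
  rewrite /v /gh mulr_sumr.
  under eq_bigr => j _ do rewrite mulr_sumr.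
  rewrite exchange_big; apply: eq_bigr => k _ /=.
  by rewrite mulrA; have [_ <-] := UVG i k; rewrite mulr_suml; apply: eq_bigr => j _; rewrite (GC k); ring.
have rown i : \sum_j (U i j ^+ 2 + V i j ^+ 2) = 1 by have [] := rows i i; rewrite eqxx.
(* The energies of the real and imaginary parts of a unit eigenvector add up to [2 (1 - d i)]. *)
have d_le1 i : d i <= 1.
  have eU : 0 <= \sum_a \sum_b G a b * (U i a - U i b) ^+ 2.
    by apply: sumr_ge0 => a _; apply: sumr_ge0 => b _; rewrite mulr_ge0 ?sqr_ge0.
  have eV : 0 <= \sum_a \sum_b G a b * (V i a - V i b) ^+ 2.
    by apply: sumr_ge0 => a _; apply: sumr_ge0 => b _; rewrite mulr_ge0 ?sqr_ge0.
  have : d i = \sum_k U i k * (\sum_j U i j * G j k) + \sum_k V i k * (\sum_j V i j * G j k).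
    rewrite -[LHS]mulr1 -(rown i) mulr_sumr -big_split; apply: eq_bigr => k _.
    by have [-> ->] := UVG i k => /=; ring.
  have := rown i; rewrite big_split /=.
  move: eU eV; rewrite !stochastic_energy; lra.
have const i : d i = 1 -> forall a b, U i a = U i b /\ V i a = V i b.
  move=> di a b; split; apply: irreducible_harmonic => k.
    by have [-> _] := UVG i k; rewrite di mul1r.
  by have [_ ->] := UVG i k; rewrite di mul1r.
pose z := Ordinal (ltnW hn : (0 < n)%N).
have sumc (F : 'I_n -> R) : (forall a b, F a = F b) -> \sum_j F j = n%:R * F z.
  move=> Fc; rewrite (eq_bigr (fun=> F z)) => [|j _]; last exact: Fc.
  by rewrite sumr_const card_ord mulr_natl.
(* Two constant unit vectors are proportional, hence not orthogonal; in real coordinates this is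
   Lagrange's identity. *)
have uniq1 i k : d i = 1 -> d k = 1 -> i = k.
  move=> /const ci /const ck; apply/eqP; apply: contraT => ik.
  have [] := rows i k; rewrite (negbTE ik) => h1 h2.
  have := rown i; have := rown k; move: h1 h2.
  rewrite !sumc; try by move=> a b; have [e1 e2] := ci a b; have [e3 e4] := ck a b; rewrite ?e1 ?e2 ?e3 ?e4.
  set x := U i z; set y := V i z; set p := U k z; set q := V k z.
  move=> h1 h2 h3 h4.
  have : (n%:R * (p ^+ 2 + q ^+ 2)) * (n%:R * (x ^+ 2 + y ^+ 2)) =
    (n%:R * (x * p + y * q)) ^+ 2 + (n%:R * (y * p - x * q)) ^+ 2 by ring.
  by rewrite h1 h2 h3 h4 expr0n addr0 mulr1 => /eqP; rewrite oner_eq0.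
(* [G] fixes the constant 1; without the eigenvalue 1 all its coordinates would vanish, against
   Parseval. *)
have [i0 di0] : exists i0, d i0 = 1.
  have g1 a : gh (fun=> 1) a = 1.
    by rewrite /gh -[RHS](G_row a); apply: eq_bigr => j _; rewrite mul1r GC.
  have g1E i : u (gh (fun=> 1)) i = u (fun=> 1) i /\ v (gh (fun=> 1)) i = v (fun=> 1) i.
    by split; apply: eq_bigr => j _; rewrite g1.
  apply/not_existsP => no.
  have z0 i : u (fun=> 1) i = 0 /\ v (fun=> 1) i = 0.
    have [h1 h2] := g1E i; rewrite ugh in h1; rewrite vgh in h2.
    have di : d i - 1 != 0 by rewrite subr_eq0; apply/eqP/no.
    split; apply: (mulfI di); rewrite mulr0 mulrBl mul1r ?h1 ?h2 subrr //.
  have := parseval (fun=> 1) (fun=> 1); rewrite big1 => [|i _]; last first.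
    by have [-> ->] := z0 i; rewrite !mul0r addr0.
  rewrite sumc // mulr1 => /esym/eqP; rewrite mulf_eq0 (gt_eqF n0) oner_eq0 //.
have d_lt1 i : i != i0 -> d i < 1.
  move=> ii0; rewrite lt_neqAle d_le1 andbT; apply: contra ii0 => /eqP di.
  by apply/eqP/uniq1.
have [l1 dl] := second_eigenvalue hn Gd di0 d_lt1.
have gap0 : 0 < spectral_gap G by rewrite subr_gt0.
split=> // h.
pose m := (\sum_j h j) / n%:R.
pose f i := h i - m.
have f0 : \sum_j f j = 0.
  rewrite sumrB sumr_const card_ord -[m *+ n]mulr_natl /m mulrCA divff ?gt_eqF // mulr1.
  by rewrite subrr.
have hf i j : h i - h j = f i - f j by rewrite /f; ring.
have -> : \sum_i \sum_j G i j * (h i - h j) ^+ 2 = \sum_i \sum_j G i j * (f i - f j) ^+ 2.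
  by apply: eq_bigr => i _; apply: eq_bigr => j _; rewrite hf.
have -> : \sum_i \sum_j (h i - h j) ^+ 2 = \sum_i \sum_j (f i - f j) ^+ 2.
  by apply: eq_bigr => i _; apply: eq_bigr => j _; rewrite hf.
have -> : \sum_i \sum_j (f i - f j) ^+ 2 = 2 * n%:R * \sum_i f i ^+ 2.
  have e i : \sum_j (f i - f j) ^+ 2 = n%:R * f i ^+ 2 + \sum_j f j ^+ 2.
    have -> : n%:R * f i ^+ 2 = \sum_(j < n) f i ^+ 2 - 2 * f i * \sum_j f j.
      by rewrite f0 mulr0 subr0 sumr_const card_ord mulr_natl.
    rewrite mulr_sumr -sumrB -big_split; apply: eq_bigr => j _ /=; ring.
  under eq_bigr => i _ do rewrite e.
  rewrite big_split /= -mulr_sumr sumr_const card_ord -[_ *+ n]mulr_natl; ring.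
rewrite stochastic_energy -/(gh f).
have -> : \sum_k f k * \sum_j f j * G j k = \sum_i d i * (u f i ^+ 2 + v f i ^+ 2).
  rewrite -(parseval f (gh f)); apply: eq_bigr => i _; rewrite ugh vgh; ring.
have ev : \sum_i f i ^+ 2 = \sum_i (u f i ^+ 2 + v f i ^+ 2) by rewrite -(parseval f f).
rewrite ev -sumrB.
have -> : spectral_gap G * (2 * n%:R * \sum_i (u f i ^+ 2 + v f i ^+ 2)) =
  n%:R * (2 * (spectral_gap G * \sum_i (u f i ^+ 2 + v f i ^+ 2))) by ring.
rewrite ler_pM2l // ler_pM2l // mulr_sumr; apply: ler_sum => i _.
have [->|ii0] := eqVneq i i0.
  have cz (W : 'M[R]_n) : (forall a b, W i0 a = W i0 b) -> \sum_j W i0 j * f j = 0.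
    move=> Wc; rewrite (eq_bigr (fun j => W i0 z * f j)) => [|j _]; last by rewrite (Wc z j).
    by rewrite -mulr_sumr f0 mulr0.
  rewrite /u /v !cz; try by move=> a b; have [] := const _ di0 a b.
  by rewrite expr0n /= addr0 !mulr0 subrr.
have : 0 <= u f i ^+ 2 + v f i ^+ 2 by rewrite addr_ge0 ?sqr_ge0.
set w := u f i ^+ 2 + _ => w0; have := ler_wpM2r w0 (dl i ii0).
rewrite /spectral_gap; lra.
Qed.

End SpectralGap.

(** * The zero-range process *)

Section ZeroRangeProcess.
Variables (R : realType) (n m : nat) (G : 'M[R]_n) (r : 'I_n -> nat -> R).
Notation cfg := {ffun 'I_n -> nat}.
Implicit Types (x : config n m) (y : cfg) (f : config n m -> R) (F : cfg -> R).
Local Notation sites := [set: 'I_n]%SET.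

Definition occupation x : cfg := [ffun i => occ x i].

Lemma occupation_inj : injective occupation.
Proof.
move=> x x' /ffunP e; apply/val_inj/ffunP => i; apply/val_inj.
by have := e i; rewrite !ffunE.
Qed.

Lemma big_occupation F : \sum_x F (occupation x) = \sum_(y <- states sites m) F y.
Proof.
rewrite -big_enum -(big_map occupation xpredT F); apply: perm_big; apply: uniq_perm.
- by rewrite map_inj_uniq ?enum_uniq //; apply: occupation_inj.
- exact: states_uniq.
move=> y; rewrite mem_states; apply/mapP/andP => [[x _ ->]|[/eqP sy _]].
  split; last by apply/forallP => i; rewrite inE.
  by have /eqP <- := valP x; apply/eqP; apply: eq_bigr => i _; rewrite ffunE.
have ym i : (y i < m.+1)%N by rewrite ltnS -sy (bigD1 i) //= leq_addr.
pose z : {ffun 'I_n -> 'I_m.+1} := [ffun i => Ordinal (ym i)].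
have zm : (\sum_i z i == m)%N.
  by rewrite -[X in _ == X]sy; apply/eqP; apply: eq_bigr => i _; rewrite ffunE.
exists (Sub z zm : config n m); first by rewrite mem_enum.
by apply/ffunP => i; rewrite ffunE /occ SubK ffunE.
Qed.

(** The default 1 keeps the extension positive everywhere, as [complete_log_sobolev] requires. *)
Definition extend f y : R := if [pick x | occupation x == y] is Some x then f x else 1.

Lemma extendE f x : extend f (occupation x) = f x.
Proof. by rewrite /extend; case: pickP => [x' /eqP/occupation_inj -> //|/(_ x)]; rewrite eqxx. Qed.

Lemma extend_gt0 f y : (forall x, 0 < f x) -> 0 < extend f y.
Proof. by move=> f0; rewrite /extend; case: pickP. Qed.

Lemma zrp_weightE x : zrp_weight r x = weight r (occupation x).
Proof. by apply: eq_bigr => i _; rewrite /site_weight ffunE. Qed.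

Let Z := Zpart r sites m.

Lemma zrp_expect F :
  expect (@zrp_pi R n m r) (fun x => F (occupation x)) = wsum r sites m F / Z.
Proof.
have ZE : \sum_y @zrp_weight R n m r y = Z.
  under eq_bigr => y _ do rewrite zrp_weightE.
  rewrite (big_occupation (weight r)) /Z /Zpart /wsum.
  by apply: eq_bigr => y _; rewrite mulr1.
rewrite /expect /zrp_pi ZE /wsum mulr_suml -big_occupation.
by apply: eq_bigr => x _; rewrite zrp_weightE; ring.
Qed.

Lemma zrp_Ent f :
  Ent (@zrp_pi R n m r) f = entropy (states sites m) (weight r) (extend f) / Z.
Proof.
rewrite /Ent.
have -> : expect (@zrp_pi R n m r) f = wsum r sites m (extend f) / Z.
  by rewrite -zrp_expect; apply: eq_bigr => x _; rewrite extendE.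
have -> : expect (@zrp_pi R n m r) (fun x => f x * ln (f x)) =
   wsum r sites m (fun y => extend f y * ln (extend f y)) / Z.
  by rewrite -zrp_expect; apply: eq_bigr => x _; rewrite extendE.
rewrite /entropy.
have -> : \sum_(y <- states sites m) weight r y = Z.
  by rewrite /Z /Zpart /wsum; apply: eq_bigr => y _; rewrite mulr1.
by rewrite mulrBl mulrAC.
Qed.

Lemma occupation_hop x i j : (0 < occ x i)%N ->
  occupation (hop x i j) = cadd (csub (occupation x) i) j 1.
Proof.
move=> xi; apply/ffunP => k; rewrite !ffunE hopE // muln1.
by have [->|_] := eqVneq k i; [rewrite addnBAC|rewrite !subn0].
Qed.

(** [phi x = 0] removes the diagonal of the generator and leaves the jumps. *)
Lemma zrp_gen_sum x (phi : config n m -> R) : phi x = 0 ->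
  \sum_y zrp_gen G r x y * phi y =
  \sum_i \sum_j r i (occ x i) * G i j * phi (hop x i j).
Proof.
move=> phix; rewrite /zrp_gen /zrp_op.
under eq_bigr => y _ do (rewrite mulr_suml; under eq_bigr => i _ do rewrite mulr_suml).
rewrite exchange_big; apply: eq_bigr => i _; rewrite exchange_big; apply: eq_bigr => j _ /=.
under eq_bigr => y _ do rewrite -mulrA mulrBl.
rewrite -mulr_sumr sumrB; congr (_ * _).
have pick z : \sum_y (z == y)%:R * phi y = phi z.
  rewrite (bigD1 z) //= eqxx mul1r big1 ?addr0 // => y.
  by rewrite eq_sym => /negbTE ->; rewrite mul0r.
by rewrite !pick phix subr0.
Qed.

End ZeroRangeProcess.

Section DirichletForm.
Variables (R : realType) (n m : nat) (G : 'M[R]_n) (r : 'I_n -> nat -> R).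
Hypothesis r0 : forall i, r i 0%N = 0.
Hypothesis r_gt0 : forall i k, (0 < k)%N -> 0 < r i k.
Local Notation sites := [set: 'I_n]%SET.

Lemma zrp_dirichlet (f : config n m.+1 -> R) :
  dirichlet (@zrp_gen R n m.+1 G r) (@zrp_pi R n m.+1 r)
    (fun x => Num.sqrt (f x)) (fun x => Num.sqrt (f x)) =
  (2 * Zpart r sites m.+1)^-1 *
    \sum_i \sum_j G i j * exchange_form r sites m (extend f) i j.
Proof.
rewrite /dirichlet invfM -mulrA; congr (_ * _).
pose g y := Num.sqrt (extend f y).
have exE i j : exchange_form r sites m (extend f) i j =
  wsum r sites m.+1 (fun y => r i (y i) * (g y - g (cadd (csub y i) j 1)) ^+ 2).
  rewrite (wsum_ibp r0 r_gt0 m (fun y => (g y - g (cadd (csub y i) j 1)) ^+ 2)) ?inE //.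
  by apply: eq_wsum => y _; rewrite csub_cadd.
pose H (y : {ffun 'I_n -> nat}) := \sum_i \sum_j G i j *
   (r i (y i) * (g y - g (cadd (csub y i) j 1)) ^+ 2).
transitivity (expect (@zrp_pi R n m.+1 r) (fun x => H (occupation x))).
  apply: eq_bigr => x _.
  under eq_bigr => y _ do rewrite -mulrA -mulrA.
  rewrite -mulr_sumr; congr (_ * _).
  rewrite zrp_gen_sum ?subrr ?mulr0 //.
  apply: eq_bigr => i _; apply: eq_bigr => j _.
  (* Without a particle at [i] the target configurations are meaningless, but they carry the rate
     [r i 0 = 0]. *)
  rewrite ffunE; have [xi|xi] := posnP (occ x i); first by rewrite xi r0 !mul0r mulr0.
  by rewrite /g -occupation_hop // !extendE expr2; ring.
rewrite (zrp_expect m.+1 r H) mulrC /H; congr (_ * _).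
rewrite wsum_sum; apply: eq_bigr => i _; rewrite wsum_sum; apply: eq_bigr => j _.
by rewrite wsumZ exE.
Qed.

End DirichletForm.

Theorem corollary3 (R : realType) (m n : nat) (hm : (1 <= m)%N) (hn : (2 <= n)%N)
    (G : 'M[R]_n) (Gsym : G^T = G) (Gstoch : stochastic G)
    (Girr : irreducible G)
    (r : 'I_n -> nat -> R) (r_ge0 : forall i k, 0 <= r i k)
    (r0 : forall i, r i 0%N = 0)
    (r_gt0 : forall i k, (1 <= k)%N -> 0 < r i k)
    (delta Delta : R) (delta_gt0 : 0 < delta) (Delta_gt0 : 0 < Delta)
    (r_incr : forall i k, delta <= r i k.+1 - r i k <= Delta) :
  (zrp_t_LS m G r <=
    (40 * Delta / (spectral_gap G * delta ^+ 2)
      * ln (Delta * m%:R * n%:R / delta))%:E)%E.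
Proof.
case: m hm => // m' _.
have n0 : (0 < n)%N by apply: ltnW.
pose i0 : 'I_n := Ordinal n0.
have [gap0 poincare] := spectral_gap_poincare Gsym Gstoch Girr hn.
set M := Delta * m'.+1%:R * n%:R / delta.
have nR : 0 < n%:R :> R by rewrite ltr0n.
have Z0 : 0 < Zpart r [set: 'I_n]%SET m'.+1 by apply: (Zpart_gt0 r_gt0 _ (finset.in_setT i0)).
(* Follows from [delta <= Delta] and [n >= 2]; it gives both [T = 2 M >= 4] and
   [ln (2 M) <= 2 ln M]. *)
have M2 : 2 <= M.
  have dD : delta <= Delta by have /andP[h1 h2] := r_incr i0 0%N; apply: le_trans h1 h2.
  rewrite ler_pdivlMr // -mulrA -natrM mulrC; apply: ler_pM => //; first exact: ltW.
  by rewrite ler_nat (leq_trans hn) // leq_pmull.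
have M0 : 0 < M by lra.
have lM : 0 <= ln M by apply: ln_ge0; lra.
have lT : ln (2 * M) <= 2 * ln M.
  by rewrite lnM ?posrE // mulr2n mulrDl mul1r lerD2r ler_ln ?posrE.
have T4 : 4 <= 2 * M by lra.
apply: ereal_inf_lbound; exists (40 * Delta / (spectral_gap G * delta ^+ 2) * ln M) => //=.
split; first by rewrite mulr_ge0 // divr_ge0 // mulr_ge0 ?exprn_ge0 // ltW.
move=> f f0; rewrite zrp_Ent // zrp_dirichlet // ler_pdivrMr //.
have hT : 2 * Delta * m'.+1%:R * #|[set: 'I_n]%SET|%:R <= delta * (2 * M).
  rewrite cardsT card_ord /M le_eqVlt; apply/orP; left; apply/eqP.
  by field; rewrite gt_eqF.
have := complete_log_sobolev r0 r_gt0 delta_gt0 r_incr T4 (finset.in_setT i0) hT (fun y => extend_gt0 y f0).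
rewrite cardsT card_ord => h; apply: le_trans h _.
set E := exchange_form r _ m' (extend f).
have E_ge0 i j : 0 <= E i j by apply: exchange_form_ge0.
(* Poincare inequality for each [y] separately, applied to the square root of [f] as a function of
   the site of the last particle. *)
have h1 : spectral_gap G * (\sum_i \sum_j E i j) <= n%:R * \sum_i \sum_j G i j * E i j.
  have e1 : \sum_i \sum_j E i j = wsum r [set: 'I_n]%SET m' (fun y => \sum_i \sum_j
    sqdist (extend f (cadd y i 1)) (extend f (cadd y j 1))).
    rewrite wsum_sum; apply: eq_bigr => i _.
    by rewrite wsum_sum.
  have e2 : \sum_i \sum_j G i j * E i j = wsum r [set: 'I_n]%SET m' (fun y => \sum_i \sum_j
    G i j * sqdist (extend f (cadd y i 1)) (extend f (cadd y j 1))).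
    rewrite wsum_sum; apply: eq_bigr => i _.
    by rewrite wsum_sum; apply: eq_bigr => j _; rewrite wsumZ.
  rewrite e1 e2 -!wsumZ; apply: (le_wsum r_gt0) => y _.
  exact: (poincare (fun i => Num.sqrt (extend f (cadd y i 1)))).
have eT (F : 'I_n -> 'I_n -> R) : \sum_(a in [set: 'I_n]%SET) \sum_(b in [set: 'I_n]%SET) F a b
   = \sum_a \sum_b F a b.
  by rewrite big_mkcond; apply: eq_bigr => a _; rewrite inE big_mkcond; apply: eq_bigr => b _; rewrite inE.
rewrite eT.
set S := \sum_i \sum_j G i j * E i j in h1 *.
set Q := \sum_i \sum_j E i j in h1 *.
have S0 : 0 <= S.
  by apply: sumr_ge0 => i _; apply: sumr_ge0 => j _; rewrite mulr_ge0 //; have [] := Gstoch.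
have Q0 : 0 <= Q by apply: sumr_ge0 => i _; apply: sumr_ge0.
have hQ : Q <= n%:R * S / spectral_gap G by rewrite ler_pdivlMr // mulrC.
have c0 : 0 <= Delta / delta ^+ 2 by rewrite divr_ge0 ?exprn_ge0 // ltW.
have -> : 40 * Delta / (spectral_gap G * delta ^+ 2) * ln M *
  ((2 * Zpart r [set: 'I_n]%SET m'.+1)^-1 * S) * Zpart r [set: 'I_n]%SET m'.+1 =
  10 * (Delta / delta ^+ 2) / n%:R * (2 * ln M * (n%:R * S / spectral_gap G)).
  by field; rewrite !gt_eqF.
have -> : 10 * ln (2 * M) * Delta / delta ^+ 2 / n%:R * Q =
  10 * (Delta / delta ^+ 2) / n%:R * (ln (2 * M) * Q) by ring.
apply: ler_wpM2l; first by rewrite divr_ge0 ?(ltW nR) // mulr_ge0.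
by apply: ler_pM => //; apply: ln_ge0; lra.
Qed.
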